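(* Let $\pi\in S_n$, let $(i_0,j_0)$ be an index with $n\ge i_0>j_0\ge1$, let $\sigma\in\{+1,-1\}$, and let $p$ be a nonconstant monotonic real polynomial. Consider the open set $$\mathcal H_{\pi,(i_0,j_0),\sigma}=\{M\in\mathcal U_\pi^{\mathbf{GL}} : \sigma z_{i_0j_0}>0\},$$ where $(D^\pi,Y,Z)$, $Z=(z_{ij})$, are the linearizing variables of $M$ and $D^\pi=\operatorname{diag}(\lambda_{\pi(1)},\dots,\lambda_{\pi(n)})$. On $\mathcal H_{\pi,(i_0,j_0),\sigma}$ define, for $i>j$, $$w_{i_0j_0}=\frac{\log|z_{i_0j_0}|}{p(\lambda_{\pi(i_0)})-p(\lambda_{\pi(j_0)})},$$ $$w_{ij}=\frac{z_{ij}}{|z_{i_0j_0}|^{\varepsilon_{ij}}}\ \text{ for }(i,j)\ne(i_0,j_0),\qquad \varepsilon_{ij}=\frac{p(\lambda_{\pi(i)})-p(\lambda_{\pi(j)})}{p(\lambda_{\pi(i_0)})-p(\lambda_{\pi(j_0)})}.$$ Then, under the Toda flow $\dot M=[M,\Pi_{\mathfrak o}\,p(M)]$ associated with $p$, $$\dot D^\pi=0,\quad \dot Y=0,\quad \dot w_{i_0j_0}=1,\quad \dot w_{ij}=0\ \text{ for }(i,j)\neq(i_0,j_0).$$ Thus this flow is super-integrable in $\mathcal H_{\pi,(i_0,j_0),\sigma}$.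
   Context: All matrices are real $n\times n$; $\mathcal M$ is the space of all of them and $[A,B]=AB-BA$. $P_\pi$ is the permutation matrix with $P_\pi e_i=e_{\pi(i)}$; for $D=\operatorname{diag}(\lambda_1,\dots,\lambda_n)$, $D^\pi=P_\pi^\top DP_\pi=\operatorname{diag}(\lambda_{\pi(1)},\dots,\lambda_{\pi(n)})$. $\mathcal D^{\pi_0}$ is the set of diagonal matrices with strictly decreasing diagonal entries. $\mathbf{GL}^{\mathrm{pos}}$ and $\mathbf O^{\mathrm{pos}}$ are the sets of invertible, respectively orthogonal, matrices all of whose leading principal minors are positive. $\mathbf{Lo}^1$ is the group of lower triangular matrices with unit diagonal, $\mathfrak{lo}^0$ the strictly lower triangular matrices, $\mathbf{Up}^+$ the upper triangular matrices with positive diagonal. $\mathcal U^{\mathbf{GL}}_\pi=\{X^{-1}D^\pi X : X\in\mathbf{GL}^{\mathrm{pos}},\ D\in\mathcal D^{\pi_0}\}$, an open subset of $\mathcal M$. Linearizing variables: each $M\in\mathcal U^{\mathbf{GL}}_\pi$ can be written uniquely as $M=Q^\top(Y+D^\pi)Q$ with $Q\in\mathbf O^{\mathrm{pos}}$, $Y\in\mathfrak{lo}^0$, $D\in\mathcal D^{\pi_0}$; writing uniquely $Q=LU$ with $L\in\mathbf{Lo}^1$, $U\in\mathbf{Up}^+$, one defines $Z\in\mathfrak{lo}^0$ by $Z+D^\pi=L^{-1}(Y+D^\pi)L$. The linearizing variables of $M$ are $(D^\pi,Y,Z)$. $\Pi_{\mathfrak o}:\mathcal M\to\mathfrak o$ is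 the projection associated with the direct sum $\mathcal M=\mathfrak o\oplus\mathfrak{up}$ of skew-symmetric and upper triangular matrices. A flow on a manifold of dimension $d$ is super-integrable if there exist $d-1$ functionally independent conserved quantities. *)

(* Defs.v *)
(* Real n x n matrices are 'M[R]_n.+1 with R : realType and n : nat, so
   that every positive size is covered. *)
From mathcomp Require Import all_boot all_order all_algebra all_fingroup.
From mathcomp Require Import all_classical all_reals all_analysis.
Set Implicit Arguments.
Unset Strict Implicit.
Unset Printing Implicit Defensive.
Import Order.TTheory GRing.Theory Num.Theory.
Import numFieldNormedType.Exports.
Local Open Scope classical_set_scope.
Local Open Scope ring_scope.

Section Matrices.
Context {R : realType} {n : nat}.
Implicit Types (A M X Y Z Q L U : 'M[R]_n.+1) (lam : 'rV[R]_n.+1) (s : 'S_n.+1).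

(* The case k = 0 is the empty determinant, equal to 1. *)
Definition leading_minors_pos A :=
  forall (k : nat) (hk : (k <= n.+1)%N),
    0 < \det (mxsub (widen_ord hk) (widen_ord hk) A).

Definition GLpos : set 'M[R]_n.+1 :=
  [set X | X \in unitmx /\ leading_minors_pos X].

Definition Opos : set 'M[R]_n.+1 :=
  [set Q | Q^T *m Q = 1%:M /\ leading_minors_pos Q].

(* [is_trig_mx] means lower triangular. *)
Definition Lo1 : set 'M[R]_n.+1 :=
  [set L | is_trig_mx L /\ forall i, L i i = 1].

Definition lo0 : set 'M[R]_n.+1 :=
  [set Y | is_trig_mx Y /\ forall i, Y i i = 0].

Definition upper_mx A := is_trig_mx A^T.

Definition Uppos : set 'M[R]_n.+1 :=
  [set U | upper_mx U /\ forall i, 0 < U i i].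

Definition strictly_decreasing lam :=
  forall i j : 'I_n.+1, (i < j)%N -> lam 0 j < lam 0 i.

Definition diag_perm s lam : 'M[R]_n.+1 := diag_mx (\row_i lam 0 (s i)).

(* The matrix P_s with P_s e_i = e_(s i) is [(perm_mx s)^T]. *)
Lemma diag_permE s lam :
  diag_perm s lam = ((perm_mx s)^T)^T *m diag_mx lam *m (perm_mx s)^T.
Proof.
rewrite trmxK -row_permE tr_perm_mx -col_permE.
by apply/matrixP => i j; rewrite !mxE (inj_eq perm_inj).
Qed.

Definition UGL s : set 'M[R]_n.+1 :=
  [set M | exists X lam, [/\ GLpos X, strictly_decreasing lam &
     M = invmx X *m diag_perm s lam *m X]].

Definition is_linearizing s M (v : 'M[R]_n.+1 * 'M[R]_n.+1 * 'M[R]_n.+1) :=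
  let: (Ds, Y, Z) := v in
  exists lam Q L U,
    [/\ strictly_decreasing lam, Ds = diag_perm s lam, Opos Q, lo0 Y &
        M = Q^T *m (Y + Ds) *m Q] /\
    [/\ Lo1 L, Uppos U, Q = L *m U, lo0 Z &
        Z + Ds = invmx L *m (Y + Ds) *m L].

(* Meaningful for M in [UGL s], where the linearizing variables exist and are unique;
   zero by convention for matrices without linearizing variables. *)
Definition linearizing s M : 'M[R]_n.+1 * 'M[R]_n.+1 * 'M[R]_n.+1 :=
  xget (0, 0, 0) [set v | is_linearizing s M v].

Definition lvD s M : 'M[R]_n.+1 := (linearizing s M).1.1.
Definition lvY s M : 'M[R]_n.+1 := (linearizing s M).1.2.
Definition lvZ s M : 'M[R]_n.+1 := (linearizing s M).2.

Definition Hset s (i0 j0 : 'I_n.+1) (sigma : R) : set 'M[R]_n.+1 :=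
  [set M | UGL s M /\ 0 < sigma * lvZ s M i0 j0].

(* p(lambda_(s i)) - p(lambda_(s j)); the i-th diagonal entry of D^s is lambda_(s i). *)
Definition pgap (p : {poly R}) s M (i j : 'I_n.+1) : R :=
  p.[lvD s M i i] - p.[lvD s M j j].

Definition w0 (p : {poly R}) s (i0 j0 : 'I_n.+1) M : R :=
  ln `|lvZ s M i0 j0| / pgap p s M i0 j0.

Definition eps (p : {poly R}) s (i0 j0 i j : 'I_n.+1) M : R :=
  pgap p s M i j / pgap p s M i0 j0.

Definition w (p : {poly R}) s (i0 j0 i j : 'I_n.+1) M : R :=
  lvZ s M i j / (`|lvZ s M i0 j0| `^ eps p s i0 j0 i j M).

Definition skew_mx A := A^T = - A.

Definition Pi_o A : 'M[R]_n.+1 :=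
  \matrix_(i, j) if (j < i)%N then A i j else if (i < j)%N then - A j i else 0.

(* [Pi_o] is the projection along the decomposition into a skew-symmetric and an upper
   triangular matrix. *)
Lemma Pi_oP A : skew_mx (Pi_o A) /\ upper_mx (A - Pi_o A).
Proof.
split.
  apply/matrixP => i j; rewrite !mxE.
  by case: ltngtP; rewrite ?opprK ?oppr0.
apply/is_trig_mxP => i j ltij; rewrite !mxE ltij.
exact: subrr.
Qed.

Lemma Pi_o_unique A S : skew_mx S -> upper_mx (A - S) -> S = Pi_o A.
Proof.
move=> skewS /is_trig_mxP upS.
have lowS (i j : 'I_n.+1) : (j < i)%N -> S i j = A i j.
  by move=> /upS; rewrite !mxE => /eqP; rewrite subr_eq0 => /eqP.
have Sij i j : S j i = - S i j by have /matrixP/(_ i j) := skewS; rewrite !mxE.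
apply/matrixP => i j; rewrite !mxE.
case: ltngtP => [/lowS //|/lowS <-|/val_inj <-]; first by rewrite -Sij.
by apply/eqP; rewrite -eqNr -Sij.
Qed.

Definition bracket A B : 'M[R]_n.+1 := A *m B - B *m A.

Definition toda (p : {poly R}) M : 'M[R]_n.+1 := bracket M (Pi_o (horner_mx M p)).

End Matrices.

Section Flows.
Context {R : realType} {V : normedModType R}.

Definition integral_curve (X : V -> V) (Om : set V) (J : set R) (M : R -> V) :=
  [/\ open J, is_interval J &
      forall t, J t -> Om (M t) /\ is_derive t (1 : R) M (X (M t))].

(* C^k on an open set: for k > 0, differentiable with all directional derivatives C^(k-1). *)
Fixpoint Ck (k : nat) (Om : set V) (f : V -> R) : Prop :=
  match k with
  | 0 => forall x, Om x -> {for x, continuous f}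
  | k'.+1 => (forall x, Om x -> differentiable f x) /\
             (forall v, Ck k' Om (fun x => 'D_v f x))
  end.

Definition smooth (Om : set V) (f : V -> R) := forall k, Ck k Om f.

Definition conserved (X : V -> V) (Om : set V) (f : V -> R) :=
  forall J M, integral_curve X Om J M -> forall t u, J t -> J u -> f (M t) = f (M u).

(* Independence is required at every point of [Om], not only on a dense open subset. *)
Definition functionally_independent (Om : set V) (m : nat) (f : 'I_m -> V -> R) :=
  forall x, Om x -> forall c : 'I_m -> R,
    (forall v, \sum_(k < m) c k * 'd (f k) x v = 0) -> forall k, c k = 0.

(* [d] is the dimension of the open set [Om], seen as a manifold. *)
Definition super_integrable (d : nat) (X : V -> V) (Om : set V) :=
  exists f : 'I_d.-1 -> V -> R,
    (forall k, smooth Om (f k) /\ conserved X Om (f k)) /\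
    functionally_independent Om f.

End Flows.

(* Main.v *)
(* Conjugating a matrix with simple real spectrum to lower triangular form, by Q orthogonal
   and by U = L^-1 Q upper triangular, gives Y and Z.  Along the Toda flow Q^T Q' is skew;
   as T = Q M Q^T stays lower triangular with distinct diagonal entries, the commutator
   equation for T' forces Q' = Q Pi_o(p(M)) and T' = 0.  Then L^-1 L' is the strictly lower
   part of p(Z + D), whence Z' = [p(D), Z + D], which is linear diagonal once D is constant.
   Smoothness rests on the simple eigenvalues: they are continuous by the intermediate value
   theorem, hence differentiable with derivative tr(P_i v), P_i the spectral projector, and
   P_i is rational in M and the eigenvalues, so that they are smooth by induction on the
   order; Q, L and U are then given by determinants and square roots.  Finally, if the
   derivatives of D, Y and Z all vanish in a direction then L' = 0, and Q^T Q' = U^-1 U' is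
   both skew and upper triangular, so that the direction is zero: (D, Y, w) is a local
   coordinate system, and all its coordinates but one are conserved. *)
From HB Require Import structures.
Require Import Defs.
From mathcomp Require Import all_boot all_order all_algebra all_fingroup.
From mathcomp Require Import all_classical all_reals all_analysis.
From mathcomp Require Import zify ring lra.
Set Implicit Arguments.
Unset Strict Implicit.
Unset Printing Implicit Defensive.
Import Order.TTheory GRing.Theory Num.Theory.
Import numFieldNormedType.Exports.
Local Open Scope classical_set_scope.
Local Open Scope ring_scope.

(** * Triangular matrices *)

(** No implicit function theorem is used: every factor is given by a formula whose smoothness can be
    read off. An eigenvector matrix near M0 comes from one fixed X that diagonalizes M0, by
    projecting each row of X with the spectral projector of M. The factors Q, L and U so obtained
    depend on the choice of X, but D, Y and Z do not, because they are unique; this lets the local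
    formulas be glued. The flow equations and the injectivity of the differential use the same
    linear algebra, namely the relations among Q, L, U and their derivatives along a curve. The
    variables w solve the system z_ij' = (p_i - p_j) z_ij: the logarithm of |z_i0j0| grows linearly
    and serves as a clock, and dividing z_ij by a power of |z_i0j0| removes its exponential growth.
    Independence is obtained at every point by completing the conserved quantities with the clock to
    a system whose differential is injective on a space of dimension equal to the number of
    coordinates, hence bijective. *)

Lemma ord_neq_ltn n (i j : 'I_n) : (i != j) = (i < j)%N || (j < i)%N.
Proof. exact: neq_ltn. Qed.

Section Triangular.
Context {F : fieldType} {n : nat}.
Implicit Types A B K T N : 'M[F]_n.

Lemma trig_mulmx A B : is_trig_mx A -> is_trig_mx B -> is_trig_mx (A *m B).
Proof.
move=> /is_trig_mxP hA /is_trig_mxP hB; apply/is_trig_mxP => i j ij.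
rewrite mxE big1 // => l _; case: (ltnP i l) => il; first by rewrite hA ?mul0r.
by rewrite hB ?mulr0 //; lia.
Qed.

Lemma trig_mulmx_diag A B i : is_trig_mx A -> is_trig_mx B ->
  (A *m B) i i = A i i * B i i.
Proof.
move=> /is_trig_mxP hA /is_trig_mxP hB; rewrite mxE (bigD1 i) //= big1 ?addr0 // => l.
rewrite ord_neq_ltn => /orP[] il; first by rewrite hB ?mulr0.
by rewrite hA ?mul0r.
Qed.

Lemma trigD A B : is_trig_mx A -> is_trig_mx B -> is_trig_mx (A + B).
Proof.
move=> /is_trig_mxP hA /is_trig_mxP hB; apply/is_trig_mxP => i j ij.
by rewrite mxE hA ?hB ?addr0.
Qed.

Lemma trigN A : is_trig_mx A -> is_trig_mx (- A).
Proof. by move=> /is_trig_mxP hA; apply/is_trig_mxP => i j ij; rewrite mxE hA ?oppr0. Qed.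

Lemma trigB A B : is_trig_mx A -> is_trig_mx B -> is_trig_mx (A - B).
Proof. by move=> hA hB; rewrite trigD ?trigN. Qed.

(** Forward substitution: for i < j the rows of B above row i already vanish at column j, so the
    entry (i, j) of A B reduces to A_ii B_ij. *)
Lemma trig_mulKmx A B : is_trig_mx A -> (forall i, A i i != 0) ->
  is_trig_mx (A *m B) -> is_trig_mx B.
Proof.
move=> /is_trig_mxP hA dA /is_trig_mxP hAB; apply/is_trig_mxP.
suff IH m (i j : 'I_n) : (i < m)%N -> (i < j)%N -> B i j = 0.
  by move=> i j; apply: (IH i.+1).
elim: m i j => // m IH i j im ij.
have := hAB i j ij; rewrite mxE (bigD1 i) //= big1 ?addr0.
  by move=> /eqP; rewrite mulf_eq0 (negPf (dA i)) /= => /eqP.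
move=> l; rewrite ord_neq_ltn => /orP[] il; last by rewrite hA ?mul0r.
by rewrite IH ?mulr0 //; lia.
Qed.

Lemma trig_unitmx A : is_trig_mx A -> (A \in unitmx) = [forall i, A i i != 0].
Proof.
move=> hA; rewrite unitmxE det_trig // unitfE; apply/prodf_neq0/forallP => h i //.
exact: h.
Qed.

Lemma trig_invmx A : is_trig_mx A -> is_trig_mx (invmx A).
Proof.
move=> hA; case: (boolP (A \in unitmx)) => uA; last by rewrite invmx_out.
apply: (trig_mulKmx hA); first by move: uA; rewrite trig_unitmx // => /forallP.
by rewrite mulmxV // scalar_mx_is_trig.
Qed.

Lemma trig_diag A i j : is_trig_mx A -> is_trig_mx A^T -> i != j -> A i j = 0.
Proof.
move=> /is_trig_mxP hA /is_trig_mxP hB; rewrite ord_neq_ltn => /orP[] ij; first exact: hA.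
by have := hB _ _ ij; rewrite mxE.
Qed.

(* For i < j the (i, j) entry of K T' - T K is K_ij (T'_jj - T_ii) plus terms in
   entries of K farther above the diagonal: descending induction on j - i. *)
Lemma trig_sylvester T T' K : is_trig_mx T -> is_trig_mx T' ->
  (forall i j : 'I_n, (i < j)%N -> T i i != T' j j) ->
  is_trig_mx (K *m T' - T *m K) -> is_trig_mx K.
Proof.
move=> /is_trig_mxP hT /is_trig_mxP hT' dT /is_trig_mxP hK; apply/is_trig_mxP.
suff IH m (i j : 'I_n) : (n - (j - i) < m)%N -> (i < j)%N -> K i j = 0.
  by move=> i j; apply: (IH (n - (j - i)).+1).
elim: m i j => // m IH i j im ij.
have := hK i j ij; rewrite !mxE (bigD1 j) //= [X in _ - X](bigD1 i) //=.
rewrite !big1 ?addr0.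
- move/eqP; rewrite [T i i * _]mulrC -mulrBr mulf_eq0 subr_eq0 [T' j j == _]eq_sym.
  by rewrite (negPf (dT _ _ ij)) orbF => /eqP.
- move=> l; rewrite ord_neq_ltn => /orP[] il; last by rewrite hT ?mul0r.
  by rewrite IH ?mulr0 //; have := ltn_ord j; lia.
- move=> l; rewrite ord_neq_ltn => /orP[] il; first by rewrite hT' ?mulr0.
  rewrite IH ?mul0r //; have := ltn_ord l; lia.
Qed.

(** Counterpart of [trig_sylvester] below the diagonal: the entry (i, j) of N T - T N is N_ij (T_jj
    - T_ii) plus terms in entries of N nearer the diagonal, so ascending induction on i - j
    applies. *)
Lemma strict_trig_comm0 T N : is_trig_mx T -> (forall i j, i != j -> T i i != T j j) ->
  is_trig_mx N -> (forall i, N i i = 0) -> N *m T = T *m N -> N = 0.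
Proof.
move=> /is_trig_mxP hT dT /is_trig_mxP hN dN cNT.
have hN' (i j : 'I_n) : (i <= j)%N -> N i j = 0.
  by rewrite leq_eqVlt => /orP[/eqP/val_inj <-|/hN].
suff IH m (i j : 'I_n) : (i - j < m)%N -> N i j = 0.
  by apply/matrixP => i j; rewrite mxE; apply: (IH (i - j).+1).
elim: m i j => // m IH i j im.
case: (leqP i j) => ij; first exact: hN'.
have /matrixP/(_ i j) := cNT; rewrite !mxE (bigD1 j) //= [X in _ = X](bigD1 i) //=.
rewrite !big1 ?addr0.
- move/eqP; rewrite [T i i * _]mulrC -subr_eq0 -mulrBr mulf_eq0 subr_eq0.
  have ji : j != i by rewrite ord_neq_ltn ij.
  by rewrite (negPf (dT _ _ ji)) orbF => /eqP.
- move=> l; rewrite ord_neq_ltn => /orP[] il; last by rewrite hT ?mul0r.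
  case: (leqP l j) => lj; first by rewrite hN' ?mulr0.
  by rewrite IH ?mulr0 //; lia.
- move=> l; rewrite ord_neq_ltn => /orP[] il; first by rewrite hT ?mulr0.
  case: (leqP i l) => lj; first by rewrite hN' ?mul0r.
  rewrite IH ?mul0r //; lia.
Qed.

End Triangular.

Lemma horner_mx_trig (F : fieldType) n (T : 'M[F]_n.+1) (p : {poly F}) :
  is_trig_mx T -> is_trig_mx (horner_mx T p) /\ forall i, horner_mx T p i i = p.[T i i].
Proof.
move=> hT; elim/poly_ind: p => [|p c [IH1 IH2]].
  by rewrite rmorph0; split=> [|i]; rewrite ?mx0_is_trig // mxE horner0.
rewrite rmorphD rmorphM /= horner_mx_X horner_mx_C; split.
  by rewrite trigD ?trig_mulmx ?scalar_mx_is_trig.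
by move=> i; rewrite mxE trig_mulmx_diag // IH2 !mxE eqxx hornerMXaddC.
Qed.

(** * LU and QR factorizations by determinants *)

Section LU.
Context {R : realType} {n : nat}.
Implicit Types A C X Q : 'M[R]_n.+1.

(** Indexing by [inord] makes the submatrix depend on k alone and not on a proof of k <= n + 1; it
    is the leading block only under that bound. *)
Definition lead (k : nat) A : 'M[R]_k := \matrix_(a, b) A (inord a) (inord b).

Lemma leading_minors_posP A :
  leading_minors_pos A <-> forall k, (k <= n.+1)%N -> 0 < \det (lead k A).
Proof.
have E k (hk : (k <= n.+1)%N) : mxsub (widen_ord hk) (widen_ord hk) A = lead k A.
  apply/matrixP => a b; rewrite !mxE; congr (A _ _); apply/val_inj;
  by rewrite /= inordK // (leq_trans _ hk).
by split=> H k hk; have := H k hk; rewrite E.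
Qed.

(** The first k rows of a lower triangular C are supported in the first k columns, so the sum over
    the inner index stops at k. *)
Lemma lead_trig_mul C A k : (k <= n.+1)%N -> is_trig_mx C ->
  lead k (C *m A) = lead k C *m lead k A.
Proof.
move=> hk /is_trig_mxP hC; apply/matrixP => a b; rewrite !mxE.
rewrite (bigID (fun l : 'I_n.+1 => (l < k)%N)) /= [X in _ + X]big1 ?addr0; last first.
  move=> l kl; rewrite hC ?mul0r // inordK; last by have := ltn_ord a; lia.
  by have := ltn_ord a; lia.
rewrite (big_ord_narrow hk); apply: eq_bigr => l _; rewrite !mxE.
by congr (C _ _ * A _ _); apply/val_inj; rewrite /= inordK // (leq_trans _ hk).
Qed.

Lemma det_lead_trig C k : (k <= n.+1)%N -> is_trig_mx C ->
  \det (lead k C) = \prod_(i < k) C (inord i) (inord i).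
Proof.
move=> hk /is_trig_mxP hC; rewrite det_trig; last first.
  apply/is_trig_mxP => a b ab; rewrite mxE hC // !inordK //;
  by have := ltn_ord a; have := ltn_ord b; lia.
by apply: eq_bigr => i _; rewrite mxE.
Qed.

Lemma leading_minors_pos_trig_mul C A : is_trig_mx C -> (forall i, 0 < C i i) ->
  leading_minors_pos A -> leading_minors_pos (C *m A).
Proof.
move=> tC pC /leading_minors_posP pA; apply/leading_minors_posP => k hk.
by rewrite lead_trig_mul // det_mulmx det_lead_trig // mulr_gt0 ?prodr_gt0 ?pA.
Qed.

Lemma leading_minors_pos_unit A : leading_minors_pos A -> A \in unitmx.
Proof.
move=> /leading_minors_posP/(_ n.+1 (leqnn _)).
have -> : lead n.+1 A = A by apply/matrixP => a b; rewrite mxE !inord_val.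
by rewrite unitmxE unitfE; case: ltgtP.
Qed.

(* Row k of [luC] lists the cofactors that expand det A[0..k, {0..k-1, j}] along
   its last column, whence [luC A *m A = luV A]. *)
Definition bordered A (k j : 'I_n.+1) : 'M[R]_k.+1 :=
  \matrix_(a, b) A (inord a) (if (b < k)%N then inord b else j).

Definition luV A : 'M[R]_n.+1 := \matrix_(k, j) \det (bordered A k j).

Definition luC A : 'M[R]_n.+1 := \matrix_(k, l)
  if (l < k.+1)%N then cofactor (bordered A k k) (inord l) ord_max else 0.

Lemma luC_mul A : luC A *m A = luV A.
Proof.
apply/matrixP => k j; rewrite !mxE (expand_det_col _ ord_max).
under eq_bigr => l _ do rewrite mxE.
rewrite (bigID (fun l : 'I_n.+1 => (l < k.+1)%N)) /= [X in _ + X]big1 ?addr0; last first.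
  by move=> l kl; rewrite (negPf kl) mul0r.
rewrite (big_ord_narrow (ltn_ord k)); apply: eq_bigr => l _.
have lk : (l < k.+1)%N := ltn_ord (l : 'I_k.+1).
rewrite [LHS]mulrC /= lk [bordered _ _ _ _ _]mxE /= ltnn inord_val; congr (_ * _).
  by congr (A _ _); apply/val_inj; rewrite /= inordK // (leq_trans lk).
rewrite /cofactor; congr (_ * \det _); apply/matrixP => a b; rewrite !mxE /=.
have -> // : (bump k b < k)%N; have := ltn_ord b; rewrite /bump; lia.
Qed.

Lemma luC_trig A : is_trig_mx (luC A).
Proof. by apply/is_trig_mxP => i j ij; rewrite mxE ltnS leqNgt ij. Qed.

(** For j < k the bordering column j already occurs among the first k columns, and the determinant
    vanishes. *)
Lemma luV_trig A : is_trig_mx (luV A)^T.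
Proof.
apply/is_trig_mxP => j k jk; rewrite !mxE -det_tr.
have hj : (j < k.+1)%N by lia.
apply: (@determinant_alternate _ _ _ (inord j) ord_max).
  by rewrite -val_eqE /= inordK // neq_ltn jk.
by move=> b; rewrite !mxE /= ltnn inordK // jk inord_val.
Qed.

Lemma luC_diag A k : luC A k k = \det (lead k A).
Proof.
rewrite mxE ltnSn; have -> : inord k = ord_max :> 'I_k.+1.
  by apply/val_inj; rewrite /= inordK.
rewrite /cofactor -signr_odd oddD addbb mul1r; congr (\det _).
apply/matrixP => a b; rewrite !mxE /=.
have E (c : 'I_k) : bump k c = c by rewrite /bump leqNgt ltn_ord.
by rewrite !E ltn_ord.
Qed.

Lemma luV_diag A k : luV A k k = \det (lead k.+1 A).
Proof.
rewrite mxE; congr (\det _); apply/matrixP => a b; rewrite !mxE.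
case: ltnP => // kb; congr (A _ _); apply/val_inj; rewrite /= inordK //.
  by have := ltn_ord b; lia.
by have := ltn_ord b; have := ltn_ord k; lia.
Qed.

(** Dividing row i of [luC A *m A = luV A] by the minor [luC A i i] gives the left factor a unit
    diagonal: it is the inverse of L. Both matrices are rational in the entries of A, which later
    yields smoothness. *)
Definition luU A : 'M[R]_n.+1 := \matrix_(i, j) (luV A i j / luC A i i).
Definition luLinv A : 'M[R]_n.+1 := \matrix_(i, j) (luC A i j / luC A i i).

Section Positive.
Variable A : 'M[R]_n.+1.
Hypothesis pA : leading_minors_pos A.

Lemma luC_diag_gt0 i : 0 < luC A i i.
Proof. by rewrite luC_diag; move/leading_minors_posP: pA; apply; rewrite ltnW. Qed.

Lemma luV_diag_gt0 i : 0 < luV A i i.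
Proof. by rewrite luV_diag; move/leading_minors_posP: pA; apply. Qed.

Lemma luU_Uppos : Uppos (luU A).
Proof.
split; last by move=> i; rewrite mxE divr_gt0 ?luC_diag_gt0 ?luV_diag_gt0.
apply/is_trig_mxP => i j ij; rewrite !mxE.
by have /is_trig_mxP/(_ i j ij) := luV_trig A; rewrite !mxE => ->; rewrite mul0r.
Qed.

Lemma luLinv_trig : is_trig_mx (luLinv A).
Proof.
apply/is_trig_mxP => i j ij; rewrite mxE.
by have /is_trig_mxP/(_ i j ij) := luC_trig A => ->; rewrite mul0r.
Qed.

Lemma luLinv_diag i : luLinv A i i = 1.
Proof. by rewrite mxE divff // gt_eqF ?luC_diag_gt0. Qed.

Lemma luLinv_unit : luLinv A \in unitmx.
Proof.
rewrite trig_unitmx ?luLinv_trig //; apply/forallP => i.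
by rewrite luLinv_diag oner_eq0.
Qed.

Lemma luLinv_mul : luLinv A *m A = luU A.
Proof.
apply/matrixP => i j; rewrite mxE [RHS]mxE -luC_mul [in RHS]mxE mulr_suml.
by apply: eq_bigr => l _; rewrite mxE mulrAC.
Qed.

Lemma luL_Lo1 : Lo1 (invmx (luLinv A)).
Proof.
split=> [|i]; first exact/trig_invmx/luLinv_trig.
have /matrixP/(_ i i) := mulmxV luLinv_unit.
by rewrite trig_mulmx_diag ?trig_invmx ?luLinv_trig // luLinv_diag mul1r mxE eqxx.
Qed.

Lemma lu_eq : A = invmx (luLinv A) *m luU A.
Proof. by rewrite -luLinv_mul mulmxA mulVmx ?luLinv_unit ?mul1mx. Qed.

End Positive.

(** * Orthogonalization of rows through the Gram matrix *)

Lemma mul_trmx_diag m (B : 'M[R]_(n.+1, m)) i : (B *m B^T) i i = \sum_j B i j ^+ 2.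
Proof. by rewrite mxE; apply: eq_bigr => j _; rewrite mxE expr2. Qed.

(** The product equals C S C^T with C = [luC S]: it is symmetric, and upper triangular as a product
    of two upper triangular matrices, hence diagonal. *)
Lemma luV_mul_luCT S i j : S^T = S ->
  (luV S *m (luC S)^T) i j = (luC S i i * luV S i i) *+ (i == j).
Proof.
move=> symS; have tV := luV_trig S; have tC := luC_trig S.
have tVC : is_trig_mx (luV S *m (luC S)^T)^T by rewrite trmx_mul trmxK trig_mulmx.
have VCT : (luV S *m (luC S)^T)^T = luV S *m (luC S)^T.
  by rewrite -luC_mul !trmx_mul trmxK symS mulmxA.
case: eqVneq => [<-|ij]; last by rewrite trig_diag // -VCT.
by rewrite -VCT trmx_mul trmxK trig_mulmx_diag // [_^T i i]mxE.
Qed.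

(** Gram-Schmidt by determinants, before normalization: row i is a multiple of row i of X plus a
    combination of the earlier rows, and distinct rows are orthogonal by [luV_mul_luCT] for S = X
    X^T. *)
Definition qrG X := luC (X *m X^T) *m X.

(** The Euclidean norm of row i of [qrG X]. *)
Definition qrN X i := Num.sqrt (luC (X *m X^T) i i * luV (X *m X^T) i i).

Definition qrR X : 'M[R]_n.+1 := \matrix_(i, j) (luC (X *m X^T) i j / qrN X i).

Definition qrQ X : 'M[R]_n.+1 := \matrix_(i, j) (qrG X i j / qrN X i).

Lemma trmx_gram X : (X *m X^T)^T = X *m X^T.
Proof. by rewrite trmx_mul trmxK. Qed.

Lemma qrG_gram X : qrG X *m (qrG X)^T = luV (X *m X^T) *m (luC (X *m X^T))^T.
Proof. by rewrite /qrG trmx_mul mulmxA -[_ *m X *m _]mulmxA luC_mul. Qed.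

(** The product of two consecutive minors of X X^T is the squared norm of a row of [qrG X]. That row
    is nonzero, since the corresponding row of [luC] has the smaller minor on its diagonal and X is
    invertible; positivity thus passes from k to k + 1. *)
Lemma gram_leading_minors_pos X : X \in unitmx -> leading_minors_pos (X *m X^T).
Proof.
move=> uX; apply/leading_minors_posP; elim=> [|k IH] hk.
  by rewrite det_mx00.
have {IH}dk := IH (ltnW hk); have ik : (inord k : 'I_n.+1) = k :> nat by rewrite inordK.
have Ck : luC (X *m X^T) (inord k) (inord k) = \det (lead k (X *m X^T)).
  by rewrite luC_diag ik.
have Vk : luV (X *m X^T) (inord k) (inord k) = \det (lead k.+1 (X *m X^T)).
  by rewrite luV_diag ik.
rewrite -(pmulr_rgt0 _ dk) -Ck -Vk.
have := luV_mul_luCT (inord k) (inord k) (trmx_gram X); rewrite eqxx mulr1n => <-.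
rewrite -qrG_gram mul_trmx_diag lt_def sumr_ge0 ?andbT; last by move=> *; exact: sqr_ge0.
apply: contraTneq dk => /eqP; rewrite psumr_eq0; last by move=> *; exact: sqr_ge0.
move=> /allP G0; suff /rowP/(_ (inord k)) : row (inord k) (luC (X *m X^T)) = 0.
  by rewrite -Ck !mxE => ->; rewrite ltxx.
rewrite -[row _ _](mulmxK uX) -row_mul -/(qrG X).
suff -> : row (inord k) (qrG X) = 0 by rewrite mul0mx.
apply/rowP => j; have := G0 j (mem_index_enum _).
by rewrite sqrf_eq0 /= ![_ 0 j]mxE => /eqP.
Qed.

Section Unit.
Variable X : 'M[R]_n.+1.
Hypothesis uX : X \in unitmx.
Let pS := gram_leading_minors_pos uX.

Lemma qrN_gt0 i : 0 < qrN X i.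
Proof. by rewrite sqrtr_gt0 mulr_gt0 ?luC_diag_gt0 ?luV_diag_gt0. Qed.

Lemma qrR_trig : is_trig_mx (qrR X).
Proof.
apply/is_trig_mxP => i j ij; rewrite mxE.
by have /is_trig_mxP/(_ i j ij) := luC_trig (X *m X^T) => ->; rewrite mul0r.
Qed.

Lemma qrR_diag_gt0 i : 0 < qrR X i i.
Proof. by rewrite mxE divr_gt0 ?luC_diag_gt0 ?qrN_gt0. Qed.

Lemma qr_eq : qrQ X = qrR X *m X.
Proof.
apply/matrixP => i j; rewrite [LHS]mxE [RHS]mxE [qrG X i j]mxE mulr_suml.
by apply: eq_bigr => l _; rewrite [in RHS]mxE mulrAC.
Qed.

Lemma qrQ_orth : qrQ X *m (qrQ X)^T = 1%:M.
Proof.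
apply/matrixP => i j; rewrite mxE.
transitivity ((qrG X *m (qrG X)^T) i j / (qrN X i * qrN X j)).
  rewrite mxE mulr_suml; apply: eq_bigr => l _; by rewrite !mxE mulf_div.
rewrite qrG_gram luV_mul_luCT ?trmx_gram // [RHS]mxE.
case: eqVneq => [<-|_]; last by rewrite ?mulr0n mul0r.
rewrite -expr2 sqr_sqrtr; last by rewrite mulr_ge0 // ltW ?luC_diag_gt0 ?luV_diag_gt0.
by rewrite mulr1n divff // mulf_neq0 // gt_eqF ?luC_diag_gt0 ?luV_diag_gt0.
Qed.

End Unit.

(** Q = R X with R lower triangular and positive on the diagonal, and such a left factor keeps
    leading minors positive. *)
Lemma qrQ_Opos X : GLpos X -> Opos (qrQ X).
Proof.
move=> [uX pX]; split; first exact/mulmx1C/qrQ_orth.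
rewrite qr_eq; apply: leading_minors_pos_trig_mul => //; first exact: qrR_trig.
exact: qrR_diag_gt0.
Qed.

End LU.

(** * Existence and uniqueness of the linearizing variables *)

Section Linearizing.
Context {R : realType} {n : nat}.
Implicit Types (M Q L U K T D : 'M[R]_n.+1) (lam : 'rV[R]_n.+1) (s : 'S_n.+1).

Lemma sd_neq lam i j : strictly_decreasing lam -> i != j -> lam 0 i != lam 0 j.
Proof.
by move=> sd; rewrite ord_neq_ltn neq_lt => /orP[/sd ->|/sd ->]; rewrite ?orbT.
Qed.

(** The root lam_i is some lam'_j. An index j < i is impossible, since it would give lam_j = lam'_j
    = lam_i; so j >= i and lam'_j <= lam'_i. *)
Lemma sd_le_of_roots lam lam' : strictly_decreasing lam -> strictly_decreasing lam' ->
  \prod_i ('X - (lam 0 i)%:P) = \prod_i ('X - (lam' 0 i)%:P) ->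
  forall i : 'I_n.+1, (forall j : 'I_n.+1, (j < i)%N -> lam 0 j = lam' 0 j) -> lam 0 i <= lam' 0 i.
Proof.
move=> sd sd' E i IH.
have : root (\prod_i ('X - (lam 0 i)%:P)) (lam 0 i).
  by apply/rootP; rewrite horner_prod (bigD1 i) //= !hornerE subrr mul0r.
rewrite E => /rootP; rewrite horner_prod => /eqP/prodf_eq0[j _].
rewrite !hornerE subr_eq0 => /eqP lamij; rewrite lamij.
case: (ltngtP i j) => [ij|ji|/val_inj-> //]; first by rewrite ltW ?sd'.
have ij : i != j by rewrite ord_neq_ltn ji orbT.
by have := sd_neq sd ij; rewrite lamij (IH _ ji) eqxx.
Qed.

Lemma sd_roots_uniq lam lam' : strictly_decreasing lam -> strictly_decreasing lam' ->
  \prod_i ('X - (lam 0 i)%:P) = \prod_i ('X - (lam' 0 i)%:P) -> lam = lam'.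
Proof.
move=> sd sd' E; apply/rowP.
suff IH m (i : 'I_n.+1) : (i < m)%N -> lam 0 i = lam' 0 i by move=> i; apply: (IH i.+1).
elim: m i => // m IH i im.
have {}IH (j : 'I_n.+1) : (j < i)%N -> lam 0 j = lam' 0 j by move=> ji; apply: IH; lia.
apply/le_anti/andP; split; first exact: sd_le_of_roots.
by apply: sd_le_of_roots => // j ji; rewrite IH.
Qed.

Lemma char_poly_conj M T Q : Q \in unitmx -> Q *m M = T *m Q -> char_poly M = char_poly T.
Proof.
move=> uQ E; have uQX : map_mx polyC Q \in unitmx by rewrite map_unitmx.
have EX : map_mx polyC Q *m char_poly_mx M = char_poly_mx T *m map_mx polyC Q.
  by rewrite mulmxBr mulmxBl -!map_mxM E scalar_mxC.
rewrite /char_poly; apply: (mulfI (_ : \det (map_mx polyC Q) != 0)).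
  by move: uQX; rewrite unitmxE; apply: contraTneq => ->; rewrite unitr0.
by rewrite -det_mulmx EX det_mulmx mulrC.
Qed.

Lemma char_poly_trig_perm T lam s : is_trig_mx T -> (forall i, T i i = lam 0 (s i)) ->
  char_poly T = \prod_i ('X - (lam 0 i)%:P).
Proof.
move=> tT dT; rewrite char_poly_trig // [RHS](reindex_inj (@perm_inj _ s)).
by apply: eq_bigr => i _; rewrite dT.
Qed.

Lemma Opos_trmx Q : Opos Q -> Q *m Q^T = 1%:M.
Proof. by move=> [] /mulmx1C. Qed.

Lemma Opos_unit Q : Opos Q -> Q \in unitmx.
Proof. by move=> [] _ /leading_minors_pos_unit. Qed.

Lemma Lo1_unit L : Lo1 L -> L \in unitmx.
Proof.
by move=> [tL dL]; rewrite trig_unitmx //; apply/forallP => i; rewrite dL oner_eq0.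
Qed.

Lemma Uppos_unit U : Uppos U -> U \in unitmx.
Proof.
move=> [tU dU]; rewrite -unitmx_tr trig_unitmx //; apply/forallP => i.
by rewrite mxE gt_eqF.
Qed.

Lemma Lo1_inv L : Lo1 L -> Lo1 (invmx L).
Proof.
move=> lL; have uL := Lo1_unit lL; case: lL => tL dL; split; first exact: trig_invmx.
move=> i; have /matrixP/(_ i i) := mulmxV uL.
by rewrite trig_mulmx_diag ?trig_invmx // dL mul1r mxE eqxx.
Qed.

(** K = Q Q'^T satisfies K T' = T K, hence is lower triangular. Being orthogonal it is then diagonal
    with entries 1 or -1, and the leading minors of Q are those of K times those of Q', which leaves
    only the sign +1. *)
Lemma Opos_triangularization_uniq M Q Q' T T' lam s : strictly_decreasing lam ->
  Opos Q -> Opos Q' -> is_trig_mx T -> is_trig_mx T' ->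
  (forall i, T i i = lam 0 (s i)) -> (forall i, T' i i = lam 0 (s i)) ->
  Q *m M = T *m Q -> Q' *m M = T' *m Q' -> Q = Q'.
Proof.
move=> sd oQ oQ' tT tT' dT dT' E E'; pose K := Q *m Q'^T.
have QK : Q = K *m Q' by rewrite /K -mulmxA (proj1 oQ') mulmx1.
have KT' : K *m T' = T *m K.
  have E'' : Q'^T *m T' = M *m Q'^T.
    by rewrite -[LHS]mulmx1 -(Opos_trmx oQ') mulmxA -[Q'^T *m T' *m Q']mulmxA -E'
      mulmxA (proj1 oQ') mul1mx.
  by rewrite /K -mulmxA E'' !mulmxA E.
have tK : is_trig_mx K.
  apply: (@trig_sylvester _ _ T T'); rewrite ?KT' ?subrr ?mx0_is_trig //.
  move=> i j ij; rewrite dT dT'; apply: sd_neq => //.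
  by rewrite (inj_eq perm_inj) ord_neq_ltn ij.
have KKT : K *m K^T = 1%:M.
  by rewrite /K trmx_mul trmxK mulmxA -[_ *m _ *m Q']mulmxA (proj1 oQ') mulmx1 Opos_trmx.
have uK : K \in unitmx by case: (mulmx1_unit KKT).
have tK' : is_trig_mx K^T.
  have -> : K^T = invmx K by rewrite -[RHS]mulmx1 -KKT mulmxA mulVmx ?mul1mx.
  exact: trig_invmx.
have KK i : K i i ^+ 2 = 1.
  have /matrixP/(_ i i) := KKT; rewrite mxE (bigD1 i) //= big1 ?addr0; last first.
    by move=> j ji; rewrite trig_diag 1?eq_sym ?mul0r.
  by rewrite !mxE eqxx expr2.
have pK k : (k <= n.+1)%N -> 0 < \prod_(i < k) K (inord i) (inord i).
  move=> hk; rewrite -det_lead_trig //.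
  move/leading_minors_posP: (proj2 oQ) => /(_ _ hk).
  move/leading_minors_posP: (proj2 oQ') => /(_ _ hk) p1.
  by rewrite {1}QK lead_trig_mul // det_mulmx (pmulr_lgt0 _ p1).
have pKi i : 0 < K i i.
  have := pK i.+1 (ltn_ord i); rewrite big_ord_recr /= inord_val pmulr_rgt0 //.
  exact/pK/ltnW.
suff K1 : K = 1%:M by rewrite QK K1 mul1mx.
apply/matrixP => i j; rewrite [RHS]mxE; case: (eqVneq i j) => [<-|ij]; last by rewrite trig_diag.
by have /eqP := KK i; rewrite sqrp_eq1 ?ltW // => /eqP.
Qed.

(** The quotient L'^-1 L = U' U^-1 is lower and upper triangular with unit diagonal. *)
Lemma lu_uniq L L' U U' : Lo1 L -> Lo1 L' -> Uppos U -> Uppos U' ->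
  L *m U = L' *m U' -> L = L'.
Proof.
move=> lL lL' uU uU' E; pose K := invmx L' *m L.
have [uL uL' uUu] := And3 (Lo1_unit lL) (Lo1_unit lL') (Uppos_unit uU).
have KE : K = U' *m invmx U.
  by rewrite /K -[L](mulmxK uUu) E -mulmxA mulKmx.
have [tLi dLi] := Lo1_inv lL'.
have tK : is_trig_mx K by rewrite trig_mulmx //; case: lL.
have tK' : is_trig_mx K^T.
  by rewrite KE trmx_mul trmx_inv trig_mulmx ?trig_invmx //; [case: uU|case: uU'].
suff K1 : K = 1%:M by rewrite -[L](mulKVmx uL') -/K K1 mulmx1.
apply/matrixP => i j; rewrite [RHS]mxE; case: (eqVneq i j) => [<-|ij]; last by rewrite trig_diag.
by case: lL => tL dL; rewrite /K trig_mulmx_diag // dLi dL mulr1.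
Qed.

Lemma diag_perm_trig s lam : is_trig_mx (diag_perm s lam).
Proof. exact: diag_mx_is_trig. Qed.

Lemma diag_permEii s lam i : diag_perm s lam i i = lam 0 (s i).
Proof. by rewrite !mxE eqxx. Qed.

Lemma is_linearizing_uniq s M v v' :
  is_linearizing s M v -> is_linearizing s M v' -> v = v'.
Proof.
case: v v' => [[D Y] Z] [[D' Y'] Z'].
move=> [lam [Q [L [U [[sd DE oQ [tY dY] ME]]]]]] [lL uU QLU _ ZE].
move=> [lam' [Q' [L' [U' [[sd' DE' oQ' [tY' dY'] ME']]]]]] [lL' uU' QLU' _ ZE'].
have diagE l (W : 'M[R]_n.+1) : (forall i, W i i = 0) ->
    forall i, (W + diag_perm s l) i i = l 0 (s i).
  by move=> dW i; rewrite mxE diag_permEii dW add0r.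
have QM : Q *m M = (Y + D) *m Q by rewrite ME !mulmxA Opos_trmx ?mul1mx.
have QM' : Q' *m M = (Y' + D') *m Q' by rewrite ME' !mulmxA Opos_trmx ?mul1mx.
have tT : is_trig_mx (Y + D) by rewrite trigD // DE diag_perm_trig.
have tT' : is_trig_mx (Y' + D') by rewrite trigD // DE' diag_perm_trig.
have lamE : lam = lam'.
  apply: sd_roots_uniq => //.
  rewrite -(@char_poly_trig_perm (Y + D) lam s) //; last by rewrite DE; exact: diagE.
  rewrite -(@char_poly_trig_perm (Y' + D') lam' s) //; last by rewrite DE'; exact: diagE.
  by rewrite -(char_poly_conj (Opos_unit oQ) QM) -(char_poly_conj (Opos_unit oQ') QM').
have DD : D = D' by rewrite DE DE' lamE.
have QQ : Q = Q'.
  apply: (Opos_triangularization_uniq sd oQ oQ' tT tT' _ _ QM QM') => i.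
    by rewrite DE diagE.
  by rewrite DE' -lamE diagE.
have YY : Y = Y'.
  apply: (addIr D'); rewrite -[in LHS]DD -[LHS]mulmx1 -(Opos_trmx oQ) mulmxA -QM.
  by rewrite QQ QM' -mulmxA Opos_trmx // mulmx1.
have LL : L = L' by apply: (lu_uniq lL lL' uU uU'); rewrite -QLU -QLU'.
by rewrite DD YY; congr (_, _, _); apply: (addIr D'); rewrite ZE' -DD ZE YY LL.
Qed.

Lemma linearizingE s M v : is_linearizing s M v -> linearizing s M = v.
Proof.
move=> vM; rewrite /linearizing; case: xgetP => [x _ xM|/(_ v) //].
exact: is_linearizing_uniq xM vM.
Qed.

Lemma trig_conj_diag T K i : is_trig_mx T -> is_trig_mx K -> K \in unitmx ->
  is_trig_mx (invmx K *m T *m K) /\ (invmx K *m T *m K) i i = T i i.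
Proof.
move=> tT tK uK; have t1 : is_trig_mx (invmx K *m T *m K) by rewrite !trig_mulmx ?trig_invmx.
split=> //; have Ki : K i i != 0 by move: uK; rewrite trig_unitmx // => /forallP.
apply: (mulfI Ki); rewrite -trig_mulmx_diag // -!mulmxA mulKVmx // mulrC.
by rewrite trig_mulmx_diag.
Qed.

Lemma Uppos_invmx Q L U : Opos Q -> Lo1 L -> Uppos U -> Q = L *m U ->
  invmx U = Q^T *m L.
Proof.
move=> oQ lL uU QE; have uL := Lo1_unit lL; have uU' := Uppos_unit uU.
have UE : U = invmx L *m Q by rewrite QE mulKmx.
rewrite -[RHS]mul1mx -(mulVmx uU') -mulmxA -[LHS]mulmx1; congr (_ *m _).
by rewrite UE mulmxA -[invmx L *m Q *m _]mulmxA Opos_trmx // mulmx1 mulVmx.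
Qed.

Lemma lu_conj M Q L U : Opos Q -> Lo1 L -> Uppos U -> Q = L *m U ->
  U *m M *m invmx U = invmx L *m (Q *m M *m Q^T) *m L.
Proof.
move=> oQ lL uU QE; have UE : U = invmx L *m Q by rewrite QE mulKmx ?Lo1_unit.
by rewrite (Uppos_invmx oQ lL uU QE) {1}UE !mulmxA.
Qed.

(** Q M Q^T and U M U^-1 stand for Y + D and Z + D; keeping these sums whole makes every relation a
    conjugation. *)
Definition frame s M lam Q L U :=
  [/\ strictly_decreasing lam, Opos Q, Lo1 L, Uppos U & Q = L *m U] /\
  [/\ is_trig_mx (Q *m M *m Q^T), forall i, (Q *m M *m Q^T) i i = lam 0 (s i),
      is_trig_mx (U *m M *m invmx U) & forall i, (U *m M *m invmx U) i i = lam 0 (s i)].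

Lemma frame_linearizing s M lam Q L U : frame s M lam Q L U ->
  linearizing s M = (diag_perm s lam, Q *m M *m Q^T - diag_perm s lam,
                     U *m M *m invmx U - diag_perm s lam).
Proof.
move=> [[sd oQ lL uU QE] [tT dT tZ dZ]]; have E := lu_conj M oQ lL uU QE.
apply: linearizingE; exists lam, Q, L, U; split; split => //.
- split=> [|i]; first by rewrite trigB ?diag_perm_trig.
  by rewrite mxE dT mxE diag_permEii subrr.
- by rewrite subrK !mulmxA (proj1 oQ) mul1mx -mulmxA (proj1 oQ) mulmx1.
- split=> [|i]; first by rewrite trigB ?diag_perm_trig.
  by rewrite mxE dZ mxE diag_permEii subrr.
- by rewrite !subrK.
Qed.

(** Since Q = R X with R lower triangular, Q M Q^T = R D R^-1 is lower triangular with the diagonal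
    of D; conjugating further by L gives the same for U M U^-1. *)
Lemma frame_of_GLpos s M lam X : GLpos X -> strictly_decreasing lam ->
  X *m M = diag_perm s lam *m X ->
  let Q := qrQ X in frame s M lam Q (invmx (luLinv Q)) (luU Q).
Proof.
move=> gX sd XM Q; have [uX pX] := gX.
have oQ : Opos Q by exact: qrQ_Opos.
have pQ := proj2 oQ; have QE := lu_eq pQ.
have lL := luL_Lo1 pQ; have uU := luU_Uppos pQ.
set L := invmx _ in QE lL *; set U := luU Q in QE uU *.
have tR := qrR_trig X; have dR := qrR_diag_gt0 uX.
have uR : qrR X \in unitmx.
  by rewrite trig_unitmx //; apply/forallP => i; rewrite gt_eqF.
have QM : Q *m M = qrR X *m diag_perm s lam *m X by rewrite /Q qr_eq -mulmxA XM mulmxA.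
have XQ : X *m Q^T = invmx (qrR X).
  by rewrite -[LHS](mulKmx uR) [qrR X *m _]mulmxA -qr_eq Opos_trmx // mulmx1.
have TE : Q *m M *m Q^T = invmx (invmx (qrR X)) *m diag_perm s lam *m invmx (qrR X).
  by rewrite invmxK QM -mulmxA XQ.
have tdT i : is_trig_mx (Q *m M *m Q^T) /\ (Q *m M *m Q^T) i i = lam 0 (s i).
  rewrite TE -(diag_permEii s lam i).
  by apply: trig_conj_diag; rewrite ?diag_perm_trig ?trig_invmx ?unitmx_inv.
have uL := Lo1_unit lL; have uU' := Uppos_unit uU.
have tdZ i : is_trig_mx (U *m M *m invmx U) /\ (U *m M *m invmx U) i i = lam 0 (s i).
  have [tT dT] := tdT i; rewrite (lu_conj _ oQ lL uU QE) -dT; apply: trig_conj_diag => //.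
  by case: lL.
by split; split=> // [|i||i]; [case: (tdT 0)|case: (tdT i)|case: (tdZ 0)|case: (tdZ i)].
Qed.

(** A form without inverses, in which the rows of X are left eigenvectors of M. *)
Lemma UGL_eigen s M : UGL s M <-> exists X lam, [/\ GLpos X, strictly_decreasing lam &
  X *m M = diag_perm s lam *m X].
Proof.
split=> -[X [lam [gX sd E]]]; exists X, lam; have [uX _] := gX; split=> //.
  by rewrite E !mulmxA mulmxV // mul1mx.
by rewrite -mulmxA -E mulKmx.
Qed.

End Linearizing.

(** * Functions of class C^k *)

Section Differentiability.
Context {R : realType} {V W : normedModType R}.

Lemma differentiable_eps (f : V -> W) (x : V) (df : {linear V -> W}) :
  continuous df ->
  (forall e : R, 0 < e -> \forall h \near (0 : V),
     `|f (h + x) - (f x + df h)| <= e * `|h|) ->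
  differentiable f x /\ 'd f x = df :> (V -> W).
Proof.
move=> cdf H.
have E : f \o shift x = cst (f x) + df +o_ 0 id.
  by apply/eqaddoP => e e0; exact: H.
by split; [apply/diff_locallyP|]; rewrite (diff_unique cdf E).
Qed.

Lemma diff_eps (f : V -> W) (x : V) : differentiable f x ->
  forall e : R, 0 < e -> \forall h \near (0 : V),
     `|f (h + x) - (f x + 'd f x h)| <= e * `|h|.
Proof. by move=> /diff_locally/eqaddoP. Qed.

Lemma near_eq_differentiable (f g : V -> W) (x : V) :
  {near x, f =1 g} -> differentiable f x -> differentiable g x.
Proof.
move=> fg df; have cdf := diff_continuous df.
apply: (proj1 (differentiable_eps cdf _)).
move=> e e0; rewrite -(nbhs_singleton fg).
have fg0 : \forall h \near (0 : V), f (h + x) = g (h + x).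
  by move: fg; rewrite (near_shift 0 x) subr0.
near=> h; rewrite -(near fg0 h) //; near: h; exact: diff_eps.
Unshelve. all: by end_near. Qed.

End Differentiability.

Section RealValued.
Context {R : realType} {V : normedModType R}.
Implicit Types (f g h : V -> R) (Om : set V).

(** As g vanishes at x, the variation of h enters only through (h(x + v) - h(x)) dg(v), which is
    o(v) by mere continuity of h. This is how eigenvalues become differentiable from their
    continuity alone. *)
Lemma differentiable_mul_continuous g h (x : V) :
  differentiable g x -> g x = 0 -> {for x, continuous h} ->
  differentiable (fun y => g y * h y) x /\
  forall v, 'D_v (fun y => g y * h y) x = h x * 'D_v g x.
Proof.
move=> dg g0 ch.
pose d (v : V) := h x * 'd g x v.
have lind : linear d by move=> a u v; rewrite /d linearP mulrDr /= mulrCA.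
pose dM := GRing.isLinear.Build _ _ _ _ _ lind.
pose dL : {linear V -> R} := HB.pack d dM.
have cd : continuous dL.
  by move=> y; apply: continuousM; [exact: cst_continuous|exact: diff_continuous].
suff [dgh E] : differentiable (fun y => g y * h y) x /\
    'd (fun y => g y * h y) x = dL :> (V -> R).
  by split=> // v; rewrite !deriveE // E.
apply: (differentiable_eps cd) => e e0.
have [K K0 dK] : exists2 K : R, 0 < K & forall v, `|'d g x v| <= K * `|v|.
  have [|K K0 dK] := @linear_lipschitz _ _ _ ('d g x); first exact: diff_continuous.
  by exists K.
(* The bound 1 in [e2] keeps |h| below |h x| + 1 near x; each of the two error terms then
   contributes at most half of e |v|. *)
pose e1 := e / 2 / (`|h x| + 1); pose e2 := Num.min 1 (e / 2 / K).
have h1 : 0 < `|h x| + 1 by rewrite ltr_wpDl.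
have e10 : 0 < e1 by rewrite !divr_gt0.
have e20 : 0 < e2 by rewrite lt_min ltr01 !divr_gt0.
have N1 := diff_eps dg e10.
have N2 : \forall v \near (0 : V), `|h (v + x) - h x| < e2.
  have : \forall y \near x, `|h y - h x| < e2.
    by move/cvgrPdist_lt : ch => /(_ _ e20); under eq_near do rewrite distrC.
  by rewrite (near_shift 0 x) subr0.
near=> v.
have n1 : `|g (v + x) - (g x + 'd g x v)| <= e1 * `|v| by near: v.
have n2 : `|h (v + x) - h x| < e2 by near: v.
rewrite g0 mul0r add0r; rewrite g0 add0r in n1.
have -> : g (v + x) * h (v + x) - dL v =
    h (v + x) * (g (v + x) - 'd g x v) + (h (v + x) - h x) * 'd g x v.
  by rewrite -[dL v]/(h x * 'd g x v); ring.
apply: (le_trans (ler_normD _ _)); rewrite !normrM.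
have hb : `|h (v + x)| <= `|h x| + 1.
  rewrite -[h (v + x)](subrK (h x)); apply: (le_trans (ler_normD _ _)).
  rewrite addrC lerD2l ltW // (lt_le_trans n2) // ge_min lexx.
  by [].
apply: (@le_trans _ _ ((`|h x| + 1) * (e1 * `|v|) + (e / 2 / K) * (K * `|v|))).
  apply: lerD; apply: ler_pM => //.
  by rewrite ltW // (lt_le_trans n2) // ge_min lexx orbT.
rewrite le_eqVlt; apply/orP; left; apply/eqP; rewrite /e1.
by field; rewrite !gt_eqF.
Unshelve. all: by end_near. Qed.

Lemma near_neq0 f (x : V) : {for x, continuous f} -> f x != 0 ->
  \forall y \near x, f y != 0.
Proof. by move=> cf fx; apply: (@cvgr_neq0 _ R^o _ _ _ f (f x)). Qed.

Lemma near_lt0 f (x : V) : {for x, continuous f} -> f x < 0 ->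
  \forall y \near x, f y < 0.
Proof. by move=> cf fx; apply: (@cvgr_lt _ _ _ _ f (f x)). Qed.

Lemma near_gt0 f (x : V) : {for x, continuous f} -> 0 < f x ->
  \forall y \near x, 0 < f y.
Proof. by move=> cf fx; apply: (@cvgr_gt _ _ _ _ f (f x)). Qed.

Lemma Ck_ext k Om f g : open Om -> (forall x, Om x -> f x = g x) ->
  Ck k Om f -> Ck k Om g.
Proof.
move=> oOm; elim: k f g => [|k IH] f g fg.
  move=> cf x Ox; have := cf x Ox; rewrite /prop_for /continuous_at -(fg x Ox).
  apply: cvg_trans; apply: near_eq_cvg; near=> y; apply: fg; near: y.
  exact: (open_nbhs_nbhs (conj oOm Ox)).
have nfg x : Om x -> {near x, f =1 g}.
  by move=> Ox; near=> y; apply: fg; near: y; exact: (open_nbhs_nbhs (conj oOm Ox)).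
move=> [df dDf]; split.
  by move=> x Ox; apply: near_eq_differentiable (nfg x Ox) (df x Ox).
move=> v; apply: IH (dDf v) => x Ox; apply: near_eq_derive; exact: nfg.
Unshelve. all: by end_near. Qed.

Lemma Ck_S k Om f : Ck k.+1 Om f -> Ck k Om f.
Proof.
elim: k f => [|k IH] f [df dDf].
  by move=> x Ox; exact/differentiable_continuous/df.
by split=> // v; apply: IH.
Qed.

Lemma Ck_continuous k Om f x : Ck k Om f -> Om x -> {for x, continuous f}.
Proof. by elim: k => [|k IH]; [apply|move=> /Ck_S]. Qed.

Lemma Ck_subset k Om Om' f : Om' `<=` Om -> Ck k Om f -> Ck k Om' f.
Proof.
move=> sOm; elim: k f => [|k IH] f; first by move=> cf x /sOm; exact: cf.
by move=> [df dDf]; split=> [x /sOm|v]; [exact: df|exact/IH/dDf].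
Qed.

(** [Ck] restricts the points at which f and its derivatives are examined, never f itself, so it can
    be checked point by point. *)
Lemma Ck_local k Om f :
  (forall x, Om x -> exists Om', Om' x /\ Ck k Om' f) -> Ck k Om f.
Proof.
elim: k f => [|k IH] f H.
  by move=> x Ox; have [Om' [Ox' cf]] := H x Ox; exact: cf.
split=> [x Ox|v]; first by have [Om' [Ox' [df _]]] := H x Ox; exact: df.
apply: IH => x Ox; have [Om' [Ox' [_ dDf]]] := H x Ox.
by exists Om'; split=> //; exact: dDf.
Qed.

Section Operations.
Variable Om : set V.
Hypothesis oOm : open Om.

Lemma Ck_cst k (a : R) : Ck k Om (fun=> a).
Proof.
elim: k a => [|k IH] a; first by move=> x _; exact: cst_continuous.
split=> [x _|v]; first exact: differentiable_cst.
by apply: (Ck_ext oOm _ (IH 0)) => x _; rewrite derive_cst.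
Qed.

Lemma CkD k f g : Ck k Om f -> Ck k Om g -> Ck k Om (fun x => f x + g x).
Proof.
elim: k f g => [|k IH] f g.
  by move=> cf cg x Ox; apply: continuousD; [exact: cf|exact: cg].
move=> [df dDf] [dg dDg]; split=> [x Ox|v].
  by apply: differentiableD; [exact: df|exact: dg].
apply: Ck_ext (IH _ _ (dDf v) (dDg v)) => // x Ox.
by rewrite -deriveD //; apply: diff_derivable; [exact: df|exact: dg].
Qed.

Lemma CkM k f g : Ck k Om f -> Ck k Om g -> Ck k Om (fun x => f x * g x).
Proof.
elim: k f g => [|k IH] f g.
  by move=> cf cg x Ox; apply: continuousM; [exact: cf|exact: cg].
move=> Cf Cg; have [[df dDf] [dg dDg]] := (Cf, Cg); split=> [x Ox|v].
  by apply: differentiableM; [exact: df|exact: dg].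
have C1 := IH _ _ (Ck_S Cf) (dDg v); have C2 := IH _ _ (Ck_S Cg) (dDf v).
apply: Ck_ext (CkD C1 C2) => // x Ox.
by symmetry; apply: deriveM; apply: diff_derivable; [exact: df|exact: dg].
Qed.

Lemma CkN k f : Ck k Om f -> Ck k Om (fun x => - f x).
Proof.
move=> Cf; apply: Ck_ext (CkM (Ck_cst k (-1)) Cf) => // x _.
by rewrite mulN1r.
Qed.

Lemma CkB k f g : Ck k Om f -> Ck k Om g -> Ck k Om (fun x => f x - g x).
Proof. by move=> Cf Cg; apply: CkD => //; exact: CkN. Qed.

Lemma Ck_sum k (I : Type) (r : seq I) (P : pred I) (f : I -> V -> R) :
  (forall i, P i -> Ck k Om (f i)) -> Ck k Om (fun x => \sum_(i <- r | P i) f i x).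
Proof.
move=> Cf; elim: r => [|i r IH].
  by under eq_fun do rewrite big_nil; exact: Ck_cst.
under eq_fun do rewrite big_cons; case Pi : (P i) => //.
by apply: CkD => //; exact: Cf.
Qed.

Lemma Ck_prod k (I : Type) (r : seq I) (P : pred I) (f : I -> V -> R) :
  (forall i, P i -> Ck k Om (f i)) -> Ck k Om (fun x => \prod_(i <- r | P i) f i x).
Proof.
move=> Cf; elim: r => [|i r IH].
  by under eq_fun do rewrite big_nil; exact: Ck_cst.
under eq_fun do rewrite big_cons; case Pi : (P i) => //.
by apply: CkM => //; exact: Cf.
Qed.

Lemma CkV k f : (forall x, Om x -> f x != 0) -> Ck k Om f ->
  Ck k Om (fun x => (f x)^-1).
Proof.
move=> f0; elim: k => [|k IH] Cf.
  by move=> x Ox; apply: continuousV; [exact: f0|exact: Cf].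
have CVf := IH (Ck_S Cf); have [df dDf] := Cf; split=> [x Ox|v].
  by apply: differentiableV; [exact: df|exact: f0].
apply: Ck_ext (CkN (CkM (CkM CVf CVf) (dDf v))) => // x Ox.
rewrite deriveV ?f0 //; last exact/diff_derivable/df.
by rewrite expr2 invfM scaleNr.
Qed.

Lemma Ck_div k f g : (forall x, Om x -> g x != 0) -> Ck k Om f -> Ck k Om g ->
  Ck k Om (fun x => f x / g x).
Proof. by move=> g0 Cf Cg; apply: CkM => //; exact: CkV. Qed.

Lemma derive_comp1 (h : R -> R) (h' : R) f (x v : V) :
  is_derive (f x) 1 h h' -> differentiable f x ->
  differentiable (fun y => h (f y)) x /\ 'D_v (fun y => h (f y)) x = h' * 'D_v f x.
Proof.
move=> [hd hv] df; have dh := (derivable1_diffP h (f x)).1 hd.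
have dhf : differentiable (h \o f) x by exact: differentiable_comp.
split=> //; rewrite deriveE // -[fun y => _]/(h \o f) diff_comp //= deriv1E //.
by rewrite derive1E hv deriveE // mulrC.
Qed.

(** Raises the order by one from h' o f to h o f. For the square root and the exponential h' is
    expressed through h, which closes an induction on the order; for the logarithm h' is the
    inverse. *)
Lemma Ck_comp1 k (h h' : R -> R) f : 
  (forall x, Om x -> is_derive (f x) (1 : R) h (h' (f x))) -> Ck k.+1 Om f ->
  Ck k Om (fun x => h' (f x)) -> Ck k.+1 Om (fun x => h (f x)).
Proof.
move=> dh Cf Ch'; have [df dDf] := Cf; split=> [x Ox|v].
  by have [] := @derive_comp1 h (h' (f x)) f x 0 (dh x Ox) (df x Ox).
apply: Ck_ext (CkM Ch' (dDf v)) => // x Ox.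
by have [_ ->] := @derive_comp1 h (h' (f x)) f x v (dh x Ox) (df x Ox).
Qed.

Lemma Ck_sqrt k f : (forall x, Om x -> 0 < f x) -> Ck k Om f ->
  Ck k Om (fun x => Num.sqrt (f x)).
Proof.
move=> f0; elim: k => [|k IH] Cf.
  by move=> x Ox; apply: continuous_comp; [exact: Cf|exact: sqrt_continuous].
apply: (@Ck_comp1 _ _ (fun y => (2 * Num.sqrt y)^-1)) => // [x Ox|].
  exact/is_derive1_sqrt/f0.
apply: CkV => [x Ox|]; first by rewrite mulf_neq0 // gt_eqF ?sqrtr_gt0 ?f0.
by apply: CkM; [exact: Ck_cst|exact/IH/Ck_S].
Qed.

Lemma Ck_expR k f : Ck k Om f -> Ck k Om (fun x => expR (f x)).
Proof.
elim: k => [|k IH] Cf.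
  by move=> x Ox; apply: continuous_comp; [exact: Cf|exact: continuous_expR].
apply: (@Ck_comp1 _ _ expR) => //.
exact/IH/Ck_S.
Qed.

Lemma Ck_ln k f : (forall x, Om x -> 0 < f x) -> Ck k Om f ->
  Ck k Om (fun x => ln (f x)).
Proof.
move=> f0; case: k => [|k] Cf.
  by move=> x Ox; apply: continuous_comp; [exact: Cf|apply: continuous_ln; exact: f0].
apply: (@Ck_comp1 _ _ GRing.inv) => // [x Ox|]; first exact/is_derive1_ln/f0.
by apply: CkV => [x Ox|]; [rewrite gt_eqF ?f0|exact: Ck_S].
Qed.

Lemma Ck_horner k (p : {poly R}) f : Ck k Om f -> Ck k Om (fun x => p.[f x]).
Proof.
move=> Cf; elim/poly_ind: p => [|p c IH].
  by under eq_fun do rewrite horner0; exact: Ck_cst.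
under eq_fun do rewrite hornerMXaddC.
by apply: CkD; [exact: CkM|exact: Ck_cst].
Qed.

Definition mxCk k m p (F : V -> 'M[R]_(m, p)) :=
  forall i j, Ck k Om (fun x => F x i j).

Lemma mxCk_mul k m p q (F : V -> 'M[R]_(m, p)) (G : V -> 'M[R]_(p, q)) :
  mxCk k F -> mxCk k G -> mxCk k (fun x => F x *m G x).
Proof.
move=> CF CG i j; under eq_fun do rewrite mxE.
by apply: Ck_sum => l _; exact: CkM.
Qed.

Lemma mxCk_tr k m p (F : V -> 'M[R]_(m, p)) : mxCk k F -> mxCk k (fun x => (F x)^T).
Proof. by move=> CF i j; under eq_fun do rewrite mxE; exact: CF. Qed.

Lemma mxCk_det k m (F : V -> 'M[R]_m) : mxCk k F -> Ck k Om (fun x => \det (F x)).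
Proof.
move=> CF; apply: Ck_sum => s _; apply: CkM; first exact: Ck_cst.
by apply: Ck_prod => i _; exact: CF.
Qed.

Lemma mxCk_cofactor k m (F : V -> 'M[R]_m) i j : mxCk k F ->
  Ck k Om (fun x => cofactor (F x) i j).
Proof.
move=> CF; apply: CkM; first exact: Ck_cst.
by apply: mxCk_det => a b; under eq_fun do rewrite !mxE; exact: CF.
Qed.

Lemma mxCk_inv k m (F : V -> 'M[R]_m) : (forall x, Om x -> F x \in unitmx) ->
  mxCk k F -> mxCk k (fun x => invmx (F x)).
Proof.
move=> uF CF i j.
apply: (@Ck_ext _ _ (fun x => (\det (F x))^-1 * cofactor (F x) j i)) => //.
  by move=> x Ox; rewrite /invmx uF // !mxE.
apply: CkM; last exact: mxCk_cofactor.
apply: CkV => [x Ox|]; last exact: mxCk_det.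
by rewrite -unitfE -unitmxE uF.
Qed.

End Operations.
End RealValued.

(** * Derivatives of matrix-valued maps *)

Section MatrixDerivative.
Context {R : realType} {V : normedModType R}.

Lemma is_derive_mxP m p (F : V -> 'M[R]_(m, p)) (x v : V) (dF : 'M[R]_(m, p)) :
  is_derive x v F dF <-> forall i j, is_derive x v (fun y => F y i j) (dF i j).
Proof.
split=> [[DF EF] i j|H].
  split; first exact: (derivable_mxP F x v).1.
  by rewrite -EF derive_mx // mxE.
have DF : derivable F x v by apply/derivable_mxP => i j; case: (H i j).
split=> //; rewrite derive_mx //; apply/matrixP => i j.
by rewrite mxE; case: (H i j).
Qed.

Lemma is_derive_mulmx m p q (F : V -> 'M[R]_(m, p)) (G : V -> 'M[R]_(p, q))
    (x v : V) dF dG :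
  is_derive x v F dF -> is_derive x v G dG ->
  is_derive x v (fun y => F y *m G y) (dF *m G x + F x *m dG).
Proof.
move=> /is_derive_mxP HF /is_derive_mxP HG; apply/is_derive_mxP => i j.
have -> : (fun y => (F y *m G y) i j) =
    \sum_l ((fun y => F y i l) * (fun y => G y l j)).
  by apply/funext => y; rewrite mxE fct_sumE.
apply: is_derive_eq; rewrite !mxE -big_split /=; apply: eq_bigr => l _.
by rewrite addrC; congr (_ + _); rewrite mulrC.
Qed.

Lemma is_derive_trmx m p (F : V -> 'M[R]_(m, p)) (x v : V) dF :
  is_derive x v F dF -> is_derive x v (fun y => (F y)^T) dF^T.
Proof.
move=> /is_derive_mxP HF; apply/is_derive_mxP => i j; rewrite mxE.
by under eq_fun do rewrite mxE.
Qed.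

Lemma is_derive_mx_near m p (F G : V -> 'M[R]_(m, p)) (x v : V) dF dG :
  (\forall y \near x, F y = G y) -> is_derive x v F dF -> is_derive x v G dG ->
  dF = dG.
Proof.
by move=> FG dFF [_ <-]; have [_ ->] := near_eq_is_derive FG dFF.
Qed.

Lemma is_derive_comp_curve (W : normedModType R) (f : V -> W) (g : R -> V) (t : R) (v : V) :
  differentiable f (g t) -> is_derive t (1 : R) g v ->
  is_derive t (1 : R) (fun u => f (g u)) ('d f (g t) v).
Proof.
move=> df [dg gv]; have dg' := (derivable1_diffP g t).1 dg.
have dfg : differentiable (f \o g) t by exact: differentiable_comp.
split; first exact: diff_derivable.
by rewrite deriveE // -[fun y => _]/(f \o g) diff_comp //= -gv deriveE.
Qed.

End MatrixDerivative.

(** * Simple eigenvalues *)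

Lemma poly_ivt_sign (R : rcfType) (p : {poly R}) (a b : R) : a <= b ->
  p.[a] * p.[b] < 0 -> exists2 x, a <= x <= b & root p x.
Proof.
move=> ab; case: (ltP p.[a] 0) => pa.
  rewrite nmulr_rlt0 // => pb; apply: poly_ivt => //.
  by rewrite !ltW.
move=> pab; have pb : p.[b] < 0.
  by move: pab; apply: contraTT; rewrite -!leNgt => pb; exact: mulr_ge0.
have [|x xab] := @poly_ivt _ (- p) a b ab; last by rewrite rootN; exists x.
by rewrite !hornerN oppr_le0 oppr_ge0 pa ltW.
Qed.

Lemma monic_roots_prod (F : fieldType) n (p : {poly F}) (r : 'I_n -> F) :
  p \is monic -> size p = n.+1 -> injective r -> (forall i, root p (r i)) ->
  p = \prod_i ('X - (r i)%:P).
Proof.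
move=> mp sp injr rp.
rewrite (@all_roots_prod_XsubC _ p [seq r i | i <- enum 'I_n]).
- by rewrite (monicP mp) scale1r big_map big_enum.
- by rewrite size_map size_enum_ord.
- by apply/allP => _ /mapP[i _ ->].
- by rewrite uniq_rootsE map_inj_uniq ?enum_uniq.
Qed.

Lemma horner_char_poly (F : comNzRingType) n (M : 'M[F]_n) (x : F) :
  (char_poly M).[x] = \det (x%:M - M).
Proof.
rewrite /char_poly -horner_evalE -det_map_mx; congr (\det _).
apply/matrixP => i j; rewrite !mxE raddfB raddfMn /= /horner_eval !hornerE.
by [].
Qed.

Section Eigenvalues.
Context {R : realType} {n : nat}.
Implicit Types (M X : 'M[R]_n.+1) (lam : 'rV[R]_n.+1) (s : 'S_n.+1).

Definition is_spectrum M lam :=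
  strictly_decreasing lam /\ char_poly M = \prod_i ('X - (lam 0 i)%:P).

Definition eigs M : 'rV[R]_n.+1 := xget 0 [set lam | is_spectrum M lam].

Lemma eigsE M lam : is_spectrum M lam -> eigs M = lam.
Proof.
move=> [sd E]; rewrite /eigs; case: xgetP => [x _ [sdx Ex]|/(_ lam) /= []] //.
by apply: sd_roots_uniq => //; rewrite -Ex.
Qed.

Lemma mxCk_id k (Om : set 'M[R]_n.+1) : open Om -> mxCk Om k id.
Proof.
move=> oOm i j; case: k => [|k].
  by move=> M _; exact: coord_continuous.
split=> [M _|v]; first exact: differentiable_coord.
apply: Ck_ext (Ck_cst oOm k (v i j)) => // M _.
apply/esym/derive_val; apply: (is_derive_mxP id M v v).1; exact: is_derive_id.
Qed.

Lemma scalar_mxCk k (Om : set 'M[R]_n.+1) (f : 'M[R]_n.+1 -> R) : open Om ->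
  Ck k Om f -> mxCk Om k (fun M => (f M)%:M : 'M[R]_n.+1).
Proof.
move=> oOm Cf i j; under eq_fun do rewrite mxE.
by case: (i == j) => //; exact: (Ck_cst _ _ 0).
Qed.

Lemma mxCkB k m p (Om : set 'M[R]_n.+1) (F G : 'M[R]_n.+1 -> 'M[R]_(m, p)) :
  open Om -> mxCk Om k F -> mxCk Om k G -> mxCk Om k (fun M => F M - G M).
Proof.
by move=> oOm CF CG i j; under eq_fun do rewrite !mxE; exact: CkB.
Qed.

Lemma det_sub_Ck k x : Ck k setT (fun M => \det (x%:M - M)).
Proof.
apply: mxCk_det; first exact: openT.
apply: mxCkB; [exact: openT|apply: scalar_mxCk|apply: mxCk_id]; try exact: openT.
exact/Ck_cst/openT.
Qed.

(** With a third of the smallest gap, the closed intervals of radius d around the eigenvalues are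
    disjoint; starting the minimum at e ensures d <= e. *)
Lemma spectral_gap lam (e : R) : strictly_decreasing lam -> 0 < e ->
  exists d, [/\ 0 < d, d <= e &
    forall i j : 'I_n.+1, (i < j)%N -> lam 0 j + d < lam 0 i - d].
Proof.
move=> sd e0.
pose d := \big[Num.min/e]_(p : 'I_n.+1 * 'I_n.+1 | (p.1 < p.2)%N)
   ((lam 0 p.1 - lam 0 p.2) / 3).
exists d; split.
- by apply: lt_bigmin => // p /sd; rewrite -subr_gt0 => h; rewrite divr_gt0.
- exact: bigmin_le_id.
- move=> i j ij.
  have : d <= (lam 0 i - lam 0 j) / 3.
    by rewrite /d (@bigmin_le_cond _ _ _ _ (i, j) (fun p => (p.1 < p.2)%N)
      (fun p => (lam 0 p.1 - lam 0 p.2) / 3)).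
  by have := sd _ _ ij; lra.
Qed.

(** Between lam_i - d and lam_i + d the characteristic polynomial of M0 changes sign, because only
    its factor of index i does. The sign condition persists near M0 and gives one root of the
    characteristic polynomial of M in each of n + 1 disjoint intervals, hence all its roots, in
    decreasing order. *)
Lemma eigs_near M0 lam0 (e : R) : is_spectrum M0 lam0 -> 0 < e ->
  \forall M \near M0, is_spectrum M (eigs M) /\
    forall i, `|eigs M 0 i - lam0 0 i| <= e.
Proof.
move=> [sd0 E0] e0; have [d [d0 de gap]] := spectral_gap sd0 e0.
pose f i M := \det ((lam0 0 i - d)%:M - M) * \det ((lam0 0 i + d)%:M - M).
have cf i : {for M0, continuous (f i)}.
  by apply: (@Ck_continuous _ _ 0 setT) => //; apply: CkM;
    [exact: openT|exact: det_sub_Ck|exact: det_sub_Ck].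
have f0 i : f i M0 < 0.
  rewrite /f -!horner_char_poly E0 !horner_prod -big_split /= (bigD1 i) //=.
  rewrite !hornerE; have -> : (lam0 0 i - d - lam0 0 i) * (lam0 0 i + d - lam0 0 i) =
    - d ^+ 2 by ring.
  rewrite nmulr_rlt0 ?oppr_lt0 ?exprn_gt0 // prodr_gt0 // => j ji.
  rewrite !hornerE; move: ji; rewrite ord_neq_ltn => /orP[/gap|/gap] h; nra.
have nf : \forall M \near M0, forall i, f i M < 0.
  apply: (filter_forall (nbhs_filter M0)) => i.
  exact: (near_lt0 (cf i) (f0 i)).
near=> M; have fM : forall i, f i M < 0 by near: M.
have rM i : exists r, lam0 0 i - d <= r <= lam0 0 i + d /\ root (char_poly M) r.
  have [||r ra rr] := @poly_ivt_sign _ (char_poly M) (lam0 0 i - d) (lam0 0 i + d).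
  - by rewrite lerD2l (le_trans _ (ltW d0)) // oppr_le0 ltW.
  - rewrite !horner_char_poly; exact: fM.
  - by exists r.
have [r {}rM] := fin_all_exists rM; pose lam := \row_i r i.
have sd : strictly_decreasing lam.
  move=> i j /gap; rewrite !mxE; have [/andP[ri _] _] := rM i.
  have [/andP[_ rj] _] := rM j; lra.
have specM : is_spectrum M lam.
  split=> //; rewrite (@monic_roots_prod _ n.+1 (char_poly M) (lam 0)).
  - by [].
  - exact: char_poly_monic.
  - exact: size_char_poly.
  - move=> i j; apply: contra_eq; exact: sd_neq.
  - by move=> i; rewrite mxE; case: (rM i).
rewrite (eigsE specM); split=> // i; rewrite mxE ler_distl.
by have [/andP[h1 h2] _] := rM i; apply/andP; split; lra.
Unshelve. all: by end_near. Qed.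

(** Equivalent to the existence of a spectrum: [eigs] takes its default value only when no row is
    one. *)
Definition simple_spectrum : set 'M[R]_n.+1 := [set M | is_spectrum M (eigs M)].

Lemma simple_spectrum_open : open simple_spectrum.
Proof.
rewrite openE => M0 /= S0.
suff : \forall M \near M0, simple_spectrum M by [].
have N := eigs_near S0 ltr01; near=> M.
by have [] : is_spectrum M (eigs M) /\ forall i, `|eigs M 0 i - eigs M0 0 i| <= 1 by near: M.
Unshelve. all: by end_near. Qed.

Lemma eigs_continuous M0 i : simple_spectrum M0 ->
  {for M0, continuous (fun M => eigs M 0 i)}.
Proof.
move=> S0; apply/(@cvgrPdist_le _ _ _ _ (nbhs_filter M0)) => e e0.
have N := eigs_near S0 e0; near=> M; rewrite distrC.
have [_] : is_spectrum M (eigs M) /\ forall i, `|eigs M 0 i - eigs M0 0 i| <= e by near: M.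
exact.
Unshelve. all: by end_near. Qed.

Lemma horner_spectrum M lam x : is_spectrum M lam ->
  \det (x%:M - M) = \prod_i (x - lam 0 i).
Proof.
move=> [_ E]; rewrite -horner_char_poly E horner_prod.
by apply: eq_bigr => i _; rewrite !hornerE.
Qed.

(* With l = lambda_i(M0) frozen, det(l - M) = prod_j (l - lambda_j(M)) exhibits
   l - lambda_i(M) as the product of a differentiable function of M vanishing at M0
   and a continuous one. *)
Lemma eigs_differentiable M0 i : simple_spectrum M0 ->
  differentiable (fun M => eigs M 0 i) M0.
Proof.
move=> S0; pose l := eigs M0 0 i.
pose q M := \prod_(j | j != i) (l - eigs M 0 j).
have cq : {for M0, continuous q}.
  apply: (@Ck_continuous _ _ 0 simple_spectrum) => //.
  apply: Ck_prod => [|j _]; first exact: simple_spectrum_open.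
  apply: CkB; first exact: simple_spectrum_open.
    exact/Ck_cst/simple_spectrum_open.
  by move=> M SM; exact: eigs_continuous.
have q0 : q M0 != 0.
  apply/prodf_neq0 => j ji; rewrite subr_eq0.
  by apply: sd_neq; [case: S0|rewrite eq_sym].
pose g M := - \det (l%:M - M).
have dg : differentiable g M0.
  by apply: differentiableN; have [+ _] := det_sub_Ck 1 l; apply.
have g0 : g M0 = 0.
  by rewrite /g (horner_spectrum _ S0) (bigD1 i) //= subrr mul0r oppr0.
have dgq : differentiable (fun M => g M * (q M)^-1) M0.
  by apply: (proj1 (differentiable_mul_continuous _ _ _)) => //; exact: continuousV.
apply: (@near_eq_differentiable _ _ _ (fun M => l + g M * (q M)^-1)); last first.
  by apply: differentiableD => //; exact: differentiable_cst.
have nq : \forall M \near M0, q M != 0 by exact: (near_neq0 cq q0).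
have nS : \forall M \near M0, simple_spectrum M.
  by apply: open_nbhs_nbhs; split=> //; exact: simple_spectrum_open.
near=> M; have qM : q M != 0 by near: M.
have SM : simple_spectrum M by near: M.
rewrite /g (horner_spectrum _ SM) (bigD1 i) //= -/(q M) mulNr mulfK //.
by rewrite opprB addrC subrK.
Unshelve. all: by end_near. Qed.

(** * Spectral projectors and local eigenvector matrices *)

Lemma row_horner_mx m (u : 'M[R]_(m, n.+1)) M mu (p : {poly R}) :
  u *m M = mu *: u -> u *m horner_mx M p = p.[mu] *: u.
Proof.
move=> uM; elim/poly_ind: p => [|p c IH].
  by rewrite rmorph0 mulmx0 horner0 scale0r.
rewrite rmorphD rmorphM /= horner_mx_X horner_mx_C mulmxDr hornerMXaddC scalerDl.
by rewrite mul_mx_scalar mulmxA IH -scalemxAl uM scalerA.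
Qed.

(** The Lagrange interpolation polynomial that is 1 at the eigenvalue i and 0 at the others,
    evaluated at M. *)
Definition eigproj i M : 'M[R]_n.+1 :=
  horner_mx M ((\prod_(j | j != i) (eigs M 0 i - eigs M 0 j))^-1 *:
               \prod_(j | j != i) ('X - (eigs M 0 j)%:P)).

(** X - lambda_i times the Lagrange polynomial is a multiple of the characteristic polynomial, which
    Cayley-Hamilton annihilates. *)
Lemma eigproj_eigen M i : simple_spectrum M ->
  eigproj i M *m M = eigs M 0 i *: eigproj i M.
Proof.
move=> [_ E]; apply/eqP; rewrite -subr_eq0 -mul_mx_scalar -mulmxBr; apply/eqP.
have -> : M - (eigs M 0 i)%:M = horner_mx M ('X - (eigs M 0 i)%:P).
  by rewrite rmorphB /= horner_mx_X horner_mx_C.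
rewrite -[_ *m _](rmorphM (horner_mx M)) -scalerAl mulrC.
have <- : char_poly M = ('X - (eigs M 0 i)%:P) * \prod_(j | j != i) ('X - (eigs M 0 j)%:P).
  by rewrite E (bigD1 i).
by apply: (etrans (horner_mxZ _ _ _)); rewrite Cayley_Hamilton scaler0.
Qed.

Lemma row_eigproj m (u : 'M[R]_(m, n.+1)) M i j : simple_spectrum M ->
  u *m M = eigs M 0 j *: u -> u *m eigproj i M = (j == i)%:R *: u.
Proof.
move=> [sd _] uM; rewrite /eigproj (row_horner_mx _ uM); congr (_ *: _).
rewrite hornerZ horner_prod; under [X in _ * X]eq_bigr do rewrite !hornerE.
case: (eqVneq j i) => [->|ji]; last by rewrite [X in _ * X](bigD1 j) //= subrr mul0r mulr0.
rewrite mulVf //; apply/prodf_neq0 => k ki; rewrite subr_eq0.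
by apply: sd_neq => //; rewrite eq_sym.
Qed.

Lemma eigproj_Ck k (Om : set 'M[R]_n.+1) i : open Om -> Om `<=` simple_spectrum ->
  (forall j, Ck k Om (fun M => eigs M 0 j)) -> mxCk Om k (eigproj i).
Proof.
move=> oOm sOm Ce.
pose c M := (\prod_(j | j != i) (eigs M 0 i - eigs M 0 j))^-1.
have Cc : Ck k Om c.
  apply: CkV => // [M /sOm[sd _]|].
    apply/prodf_neq0 => j ji; rewrite subr_eq0; apply: sd_neq => //.
    by rewrite eq_sym.
  by apply: Ck_prod => // j _; apply: CkB => //; exact: Ce.
(* Stated for any sequence of indices, so that induction can split off one factor M - lambda_j at a
   time. *)
have CP (r : seq 'I_n.+1) :
    mxCk Om k (fun M => horner_mx M (\prod_(j <- r | j != i) ('X - (eigs M 0 j)%:P))).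
  elim: r => [|j r IH].
    under eq_fun do rewrite big_nil rmorph1.
    by move=> a b; exact: Ck_cst.
  have -> : (fun M => horner_mx M (\prod_(l <- j :: r | l != i) ('X - (eigs M 0 l)%:P))) =
      fun M => (if j != i then M - (eigs M 0 j)%:M else 1%:M) *m
        horner_mx M (\prod_(l <- r | l != i) ('X - (eigs M 0 l)%:P)).
    apply/funext => M; rewrite big_cons; case: ifP => _; last by rewrite mul1mx.
    by rewrite rmorphM rmorphB /= horner_mx_X horner_mx_C.
  apply: mxCk_mul => //; case: (j != i); last by move=> a b; exact: Ck_cst.
  by apply: mxCkB => //; [exact: mxCk_id|exact: scalar_mxCk].
move=> a b; apply: Ck_ext (CkM oOm Cc (CP _ a b)) => // M _.
by rewrite /eigproj horner_mxZ mxE.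
Qed.

(** Transports the eigenvectors of one matrix to its neighbours: X stays fixed, M varies, and row a
    lands in the eigenline of index s a of M. *)
Definition eigrows s X M : 'M[R]_n.+1 := \matrix_a (row a X *m eigproj (s a) M).

Lemma row_mul_diag (d : 'rV[R]_n.+1) X a : row a (diag_mx d *m X) = d 0 a *: row a X.
Proof. by apply/rowP => j; rewrite mul_diag_mx !mxE. Qed.

Lemma diag_perm_row s lam X a : row a (diag_perm s lam *m X) = lam 0 (s a) *: row a X.
Proof. by rewrite row_mul_diag mxE. Qed.

Lemma eigrows_eigen s X M : simple_spectrum M ->
  eigrows s X M *m M = diag_perm s (eigs M) *m eigrows s X M.
Proof.
move=> SM; apply/row_matrixP => a.
by rewrite row_mul diag_perm_row !rowK -mulmxA eigproj_eigen // -scalemxAr.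
Qed.

Lemma eigrows_id s X M : simple_spectrum M ->
  X *m M = diag_perm s (eigs M) *m X -> eigrows s X M = X.
Proof.
move=> SM XM; apply/row_matrixP => a; rewrite rowK (@row_eigproj _ _ _ _ (s a)) //.
  by rewrite eqxx scale1r.
by rewrite -row_mul XM diag_perm_row.
Qed.

Lemma eigrows_Ck k (Om : set 'M[R]_n.+1) s X : open Om -> Om `<=` simple_spectrum ->
  (forall j, Ck k Om (fun M => eigs M 0 j)) -> mxCk Om k (eigrows s X).
Proof.
move=> oOm sOm Ce a b; under eq_fun do rewrite mxE.
apply: (@mxCk_mul _ _ _ oOm _ _ _ _ (fun=> row a X)).
  by move=> c d; exact: Ck_cst.
exact: eigproj_Ck.
Qed.

Lemma open_leading_minors (Om : set 'M[R]_n.+1) (F : 'M[R]_n.+1 -> 'M[R]_n.+1) :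
  open Om -> mxCk Om 0 F -> open (Om `&` [set M | leading_minors_pos (F M)]).
Proof.
move=> oOm CF; rewrite openE => M0; case=> O0 /leading_minors_posP p0.
have nO : \forall M \near M0, Om M.
  exact: (open_nbhs_nbhs (conj oOm O0)).
(* A finite index type, with k from 0 to n + 1 included, allows the neighbourhoods to be
   intersected. *)
have np : \forall M \near M0, forall k : 'I_n.+2, 0 < \det (lead k (F M)).
  apply: (filter_forall (nbhs_filter M0)) => k.
  have c : {for M0, continuous (fun M => \det (lead k (F M)))}.
    apply: (@Ck_continuous _ _ 0 Om) => //; apply: mxCk_det => // a b.
    by under eq_fun do rewrite mxE; exact: CF.
  have c0 : 0 < \det (lead k (F M0)) by apply: p0; rewrite -ltnS.
  exact: (near_gt0 c c0).
suff : \forall M \near M0, (Om `&` [set M | leading_minors_pos (F M)]) M by [].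
near=> M; split; first by near: M.
apply/leading_minors_posP => k hk; have hk' : (k < n.+2)%N by [].
have pM : forall k : 'I_n.+2, 0 < \det (lead k (F M)) by near: M.
exact: (pM (Ordinal hk')).
Unshelve. all: by end_near. Qed.

Lemma UGL_spectrum s M X lam : GLpos X -> strictly_decreasing lam ->
  X *m M = diag_perm s lam *m X -> is_spectrum M lam.
Proof.
move=> [uX _] sd XM; split=> //; rewrite (char_poly_conj uX XM).
apply: char_poly_trig_perm; first exact: diag_perm_trig.
exact: diag_permEii.
Qed.

Lemma UGL_simple s : UGL s `<=` simple_spectrum.
Proof.
move=> M /UGL_eigen[X [lam [gX sd XM]]]; rewrite /simple_spectrum /=.
have S := UGL_spectrum gX sd XM; by rewrite (eigsE S).
Qed.

Lemma UGL_eigs s M : UGL s M -> exists2 X, GLpos X & X *m M = diag_perm s (eigs M) *m X.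
Proof.
move=> /UGL_eigen[X [lam [gX sd XM]]]; exists X => //.
by rewrite (eigsE (UGL_spectrum gX sd XM)).
Qed.

(** At M0 the projected rows are X itself, so their leading minors are positive, and remain so
    nearby. Only continuity of the eigenvalues is available here; the openness of [UGL] derived from
    it precedes their smoothness. *)
Lemma eigrows_nbhs s M0 : UGL s M0 -> exists X,
  let Om := simple_spectrum `&` [set M | leading_minors_pos (eigrows s X M)] in
  [/\ open Om, Om M0 & Om `<=` UGL s].
Proof.
move=> U0; have [X gX XM] := UGL_eigs U0; have S0 := UGL_simple U0.
exists X => /=; split.
- apply: open_leading_minors; first exact: simple_spectrum_open.
  apply: eigrows_Ck => //; first exact: simple_spectrum_open.
  by move=> j M SM; exact: eigs_continuous.
- by split=> //=; rewrite eigrows_id //; case: gX.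
- move=> M [SM pM]; apply/UGL_eigen; exists (eigrows s X M), (eigs M); split.
  + by split=> //; exact: leading_minors_pos_unit.
  + by case: SM.
  + exact: eigrows_eigen.
Qed.

Lemma UGL_open s : open (UGL s : set 'M[R]_n.+1).
Proof.
rewrite openE => M0 U0; have [X [oOm O0 sOm]] := eigrows_nbhs U0.
suff : \forall M \near M0, @UGL R n s M by [].
near=> M; apply: sOm; near: M; exact: open_nbhs_nbhs.
Unshelve. all: by end_near. Qed.

Lemma eigproj_continuous M0 i a b : simple_spectrum M0 ->
  {for M0, continuous (fun M => eigproj i M a b)}.
Proof.
move=> S0; apply: (@Ck_continuous _ _ 0 simple_spectrum) => //.
apply: eigproj_Ck => //; first exact: simple_spectrum_open.
by move=> j M SM; exact: eigs_continuous.
Qed.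

Lemma eigproj_diag s M X i : GLpos X -> simple_spectrum M ->
  X *m M = diag_perm s (eigs M) *m X ->
  X *m eigproj i M = diag_mx (\row_a (s a == i)%:R) *m X.
Proof.
move=> gX SM XM; apply/row_matrixP => a; rewrite row_mul (@row_eigproj _ _ _ _ (s a)) //.
  by rewrite row_mul_diag mxE.
by rewrite -row_mul XM diag_perm_row.
Qed.

(* P(M) (M - M0) P0 = (lambda(M) - lambda(M0)) P(M) P0 for the eigenprojections
   P(M) and P0 = P(M0): only the continuity of P is needed to take derivatives. *)
Lemma derive_eigs s M0 i v : UGL s M0 ->
  'D_v (fun M => eigs M 0 i) M0 = \tr (eigproj i M0 *m v).
Proof.
move=> U0; have S0 := UGL_simple U0; have [X gX XM] := UGL_eigs U0; have [uX _] := gX.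
set P0 := eigproj i M0; pose E := diag_mx (\row_a (s a == i)%:R) : 'M[R]_n.+1.
have XP : X *m P0 = E *m X by exact: (eigproj_diag _ gX).
have EE : E *m E = E.
  apply/matrixP => a b; rewrite mul_diag_mx !mxE.
  by case: (s a == i); rewrite ?mul1r ?mul0r ?mul0rn.
have P0E : P0 = invmx X *m E *m X by rewrite -mulmxA -XP mulKmx.
have PP : P0 *m P0 = P0.
  by apply: (can_inj (mulKmx uX)); rewrite mulmxA XP -mulmxA XP mulmxA EE.
have trP : \tr P0 = 1.
  rewrite P0E mxtrace_mulC mulmxA mulmxV // mul1mx mxtrace_diag.
  rewrite (bigD1 ((s^-1)%g i)) //= big1 ?addr0; first by rewrite mxE permKV eqxx.
  by move=> a ai; rewrite mxE -(inj_eq (@perm_inj _ (s^-1)%g)) permK (negPf ai).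
have MP : M0 *m P0 = eigs M0 0 i *: P0.
  apply: (can_inj (mulKmx uX)); rewrite mulmxA XM -mulmxA XP -scalemxAr XP.
  rewrite !mulmxA scalemxAl; congr (_ *m _); apply/matrixP => a b.
  rewrite mul_diag_mx !mxE; case: eqVneq => [->|_]; last by rewrite mul0rn !mulr0.
  by [].
(* Traces of the two sides of the identity above. The factor vanishing at M0 is M - M0 in f and the
   eigenvalue difference in g; comparing derivatives gives the formula because P0 P0 = P0 has trace
   1. *)
pose f M := \tr (eigproj i M *m (M - M0) *m P0).
pose g M := (eigs M 0 i - eigs M0 0 i) * \tr (eigproj i M *m P0).
have fg : \forall M \near M0, g M = f M.
  have nS : \forall M \near M0, simple_spectrum M.
    exact: (open_nbhs_nbhs (conj simple_spectrum_open S0)).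
  near=> M; have SM : simple_spectrum M by near: M.
  rewrite /f /g mulmxBr mulmxBl raddfB /= eigproj_eigen // -mulmxA MP.
  by rewrite -scalemxAl -scalemxAr !mxtraceZ -mulrBl.
have ctr : {for M0, continuous (fun M => \tr (eigproj i M *m P0))}.
  apply: (Ck_continuous (k := 0) (Om := simple_spectrum) _ S0).
  apply: Ck_sum => [|a _]; first exact: simple_spectrum_open.
  apply: mxCk_mul; first exact: simple_spectrum_open.
    by move=> c d M SM; exact: eigproj_continuous.
  by move=> c d; exact/Ck_cst/simple_spectrum_open.
have de : differentiable (fun M => eigs M 0 i - eigs M0 0 i) M0.
  by apply: differentiableB; [exact: eigs_differentiable|exact: differentiable_cst].
have [dg Dg] := differentiable_mul_continuous de (subrr _) ctr.
have D1 : 'D_v g M0 = 'D_v (fun M => eigs M 0 i) M0.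
  rewrite Dg PP trP mul1r deriveB; last exact: derivable_cst.
    by rewrite derive_cst subr0.
  exact/diff_derivable/eigs_differentiable.
have D2 : 'D_v f M0 = \tr (P0 *m v).
  (* The trace is split into scalar products of a coordinate vanishing at M0 and a continuous entry,
     to which [differentiable_mul_continuous] applies. *)
  pose h a b M := (M a b - M0 a b) * (P0 *m eigproj i M) b a.
  have Dh a b : is_derive M0 v (h a b) (P0 b a * v a b).
    have dab : differentiable (fun M : 'M[R]_n.+1 => M a b - M0 a b) M0.
      by apply: differentiableB; [exact: differentiable_coord|exact: differentiable_cst].
    have cab : {for M0, continuous (fun M => (P0 *m eigproj i M) b a)}.
      apply: (@Ck_continuous _ _ 0 simple_spectrum) => //.
      apply: mxCk_mul; first exact: simple_spectrum_open.
        by move=> c d; exact/Ck_cst/simple_spectrum_open.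
      by move=> c d M SM; exact: eigproj_continuous.
    have [dh Dh] := differentiable_mul_continuous dab (subrr _) cab.
    split; first exact: diff_derivable.
    rewrite Dh PP; congr (_ * _); rewrite deriveB; last exact: derivable_cst.
      rewrite derive_cst subr0; apply/derive_val.
      by apply: (is_derive_mxP id M0 v v).1; exact: is_derive_id.
    exact/diff_derivable/differentiable_coord.
  have -> : f = \sum_a \sum_b h b a.
    apply/funext => M; rewrite /f mxtrace_mulC mulmxA fct_sumE.
    apply: eq_bigr => a _; rewrite mxE fct_sumE; apply: eq_bigr => b _.
    by rewrite [(M - M0) b a]mxE [(- M0) b a]mxE mulrC.
  have Dhh : is_derive M0 v (\sum_a \sum_b h b a) (\sum_a \sum_b P0 a b * v b a).
    by apply: is_derive_sum => a; apply: is_derive_sum => b; exact: Dh.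
  rewrite (derive_val (is_derive := Dhh)); apply: eq_bigr => a _.
  by rewrite [RHS]mxE.
by rewrite -D1 -D2; exact: near_eq_derive.
Unshelve. all: by end_near. Qed.

(** The induction on k treats all indices together, since the projector in tr(P_i v) involves every
    eigenvalue. *)
Lemma eigs_Ck k s i : Ck k (UGL s) (fun M => eigs M 0 i).
Proof.
have oU : open (UGL s : set 'M[R]_n.+1) by exact: UGL_open.
elim: k i => [|k IH] i.
  by move=> M /UGL_simple SM; exact: eigs_continuous.
split=> [M /UGL_simple SM|v]; first exact: eigs_differentiable.
apply: (@Ck_ext _ _ _ _ (fun M => \tr (eigproj i M *m v))) => //.
  by move=> M UM; rewrite (derive_eigs i v UM).
apply: Ck_sum => // a _; apply: mxCk_mul => //; last by move=> c d; exact: Ck_cst.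
by apply: eigproj_Ck => //; exact: UGL_simple.
Qed.

End Eigenvalues.

(** * Smooth frames and their derivatives *)

Section FactorSmoothness.
Context {R : realType} {n : nat} {V : normedModType R}.
Variables (Om : set V) (k : nat) (F : V -> 'M[R]_n.+1).
Hypotheses (oOm : open Om) (CF : mxCk Om k F).

Lemma mxCk_luC : mxCk Om k (fun x => luC (F x)).
Proof.
move=> i j; under eq_fun do rewrite mxE.
case: ltnP => _; last exact: Ck_cst.
by apply: mxCk_cofactor => // a b; under eq_fun do rewrite mxE; exact: CF.
Qed.

Lemma mxCk_luV : mxCk Om k (fun x => luV (F x)).
Proof.
move=> i j; under eq_fun do rewrite mxE.
by apply: mxCk_det => // a b; under eq_fun do rewrite mxE; exact: CF.
Qed.

Hypothesis pF : forall x, Om x -> leading_minors_pos (F x).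

Lemma mxCk_luU : mxCk Om k (fun x => luU (F x)).
Proof.
move=> i j; under eq_fun do rewrite mxE.
apply: Ck_div; [by []| |exact: mxCk_luV|exact: mxCk_luC].
by move=> x /pF px; rewrite gt_eqF ?luC_diag_gt0.
Qed.

Lemma mxCk_luLinv : mxCk Om k (fun x => luLinv (F x)).
Proof.
move=> i j; under eq_fun do rewrite mxE.
apply: Ck_div; [by []| |exact: mxCk_luC|exact: mxCk_luC].
by move=> x /pF px; rewrite gt_eqF ?luC_diag_gt0.
Qed.

End FactorSmoothness.

Section OrthogonalSmoothness.
Context {R : realType} {n : nat} {V : normedModType R}.
Variables (Om : set V) (k : nat) (F : V -> 'M[R]_n.+1).
Hypotheses (oOm : open Om) (CF : mxCk Om k F).
Hypothesis uF : forall x, Om x -> F x \in unitmx.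

Lemma mxCk_qrQ : mxCk Om k (fun x => qrQ (F x)).
Proof.
have CG : mxCk Om k (fun x => F x *m (F x)^T) by apply: mxCk_mul => //; exact: mxCk_tr.
move=> i j; under eq_fun do rewrite mxE.
apply: Ck_div; [by []|by move=> x /uF ux; rewrite gt_eqF ?qrN_gt0| |].
  exact: (mxCk_mul oOm (mxCk_luC oOm CG) CF).
apply: Ck_sqrt => // [x /uF/gram_leading_minors_pos px|].
  by rewrite mulr_gt0 ?luC_diag_gt0 ?luV_diag_gt0.
by apply: CkM => //; [exact: mxCk_luC|exact: mxCk_luV].
Qed.

End OrthogonalSmoothness.

Section Chart.
Context {R : realType} {n : nat}.
Implicit Types (M Q L U : 'M[R]_n.+1) (s : 'S_n.+1).

(** The neighbourhood and the three maps are chosen before the order k, so that one frame serves all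
    orders. *)
Lemma smooth_frame s M0 : UGL s M0 -> exists Om (Q L U : 'M[R]_n.+1 -> 'M[R]_n.+1),
  [/\ open Om, Om M0 & Om `<=` UGL s] /\
  [/\ forall k, mxCk Om k Q, forall k, mxCk Om k L, forall k, mxCk Om k U &
      forall M, Om M -> frame s M (eigs M) (Q M) (L M) (U M)].
Proof.
move=> U0; have [X [uX pX] XM] := UGL_eigs U0; have S0 := UGL_simple U0.
have oU : open (UGL s : set 'M[R]_n.+1) by exact: UGL_open.
pose Om := UGL s `&` [set M | leading_minors_pos (eigrows s X M)].
have sOm : Om `<=` UGL s by move=> M [].
have CX k : mxCk (UGL s) k (eigrows s X).
  by apply: eigrows_Ck; [exact: oU|exact: UGL_simple|move=> j; exact: eigs_Ck].
have oOm : open Om by exact: open_leading_minors.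
have CX' k : mxCk Om k (eigrows s X) by move=> i j; exact: Ck_subset (CX k i j).
have gX M : Om M -> GLpos (eigrows s X M).
  by move=> [_ pM]; split=> //; exact: leading_minors_pos_unit.
pose Q M := qrQ (eigrows s X M).
have CQ k : mxCk Om k Q by apply: mxCk_qrQ => // M /gX[].
have pQ M : Om M -> leading_minors_pos (Q M) by move=> /gX/qrQ_Opos[].
exists Om, Q, (fun M => invmx (luLinv (Q M))), (fun M => luU (Q M)); split; split=> //.
- by split=> //=; rewrite eigrows_id.
- move=> k; apply: mxCk_inv => // [M /pQ pM|]; first exact: luLinv_unit.
  exact: mxCk_luLinv.
- by move=> k; exact: mxCk_luU.
- move=> M OM; have SM := UGL_simple (sOm M OM).
  apply: frame_of_GLpos; [exact: gX|by case: SM|exact: eigrows_eigen].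
Qed.

Lemma mxCkBdiag k (Om : set 'M[R]_n.+1) s (F : 'M[R]_n.+1 -> 'M[R]_n.+1) :
  open Om -> Om `<=` UGL s -> mxCk Om k F ->
  mxCk Om k (fun M => F M - diag_perm s (eigs M)).
Proof.
move=> oOm sOm CF; apply: mxCkB => // i j; under eq_fun do rewrite !mxE.
case: (i == j); last exact: (Ck_cst _ _ 0).
by apply: Ck_subset sOm _; exact: eigs_Ck.
Qed.

Lemma lvDE s M : UGL s M -> lvD s M = diag_perm s (eigs M).
Proof.
move=> /smooth_frame[Om [Q [L [U [[_ OM _] [_ _ _ /(_ _ OM) fr]]]]]].
by rewrite /lvD (frame_linearizing fr).
Qed.

(** Each local frame computes the same Y and Z, by uniqueness, so local smoothness is smoothness on
    all of [UGL s]. *)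
Lemma lvYZ_mxCk k s : mxCk (UGL s) k (fun M => lvY s M) /\ mxCk (UGL s) k (fun M => lvZ s M).
Proof.
split=> i j; apply: Ck_local => M0 /smooth_frame[Om [Q [L [U [[oOm OM sOm] [CQ CL CU fr]]]]]];
  exists Om; split=> //.
- apply: (@Ck_ext _ _ _ _ (fun M => (Q M *m M *m (Q M)^T - diag_perm s (eigs M)) i j)) => //.
    by move=> M /fr; rewrite /lvY => /frame_linearizing ->.
  apply: mxCkBdiag => //; apply: mxCk_mul => //; last exact: mxCk_tr.
  by apply: mxCk_mul => //; exact: mxCk_id.
- apply: (@Ck_ext _ _ _ _
    (fun M => (U M *m M *m invmx (U M) - diag_perm s (eigs M)) i j)) => //.
    by move=> M /fr; rewrite /lvZ => /frame_linearizing ->.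
  apply: mxCkBdiag => //; apply: mxCk_mul => //.
    by apply: mxCk_mul => //; exact: mxCk_id.
  by apply: mxCk_inv => // M /fr[[_ _ _ /Uppos_unit]].
Qed.

Lemma lvD_mxCk k s : mxCk (UGL s) k (fun M => lvD s M).
Proof.
have oU : open (UGL s : set 'M[R]_n.+1) by exact: UGL_open.
move=> i j; apply: (@Ck_ext _ _ _ _ (fun M => diag_perm s (eigs M) i j)) => //.
  by move=> M /lvDE ->.
under eq_fun do rewrite !mxE.
by case: (i == j); [exact: eigs_Ck|exact: (Ck_cst _ _ 0)].
Qed.

End Chart.

Lemma horner_mx_intertwine (F : fieldType) n (X M T : 'M[F]_n.+1) (p : {poly F}) :
  X *m M = T *m X -> X *m horner_mx M p = horner_mx T p *m X.
Proof.
move=> XM; elim/poly_ind: p => [|p c IH]; first by rewrite !rmorph0 mulmx0 mul0mx.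
rewrite !rmorphD !rmorphM /= !horner_mx_X !horner_mx_C mulmxDr mulmxDl scalar_mxC.
by congr (_ + _); rewrite mulmxA IH -!mulmxA XM.
Qed.

(** * Linear algebra of the derivative of a frame *)

Section FrameDerivative.
Context {R : realType} {n : nat}.
Implicit Types (M Q L U T S K : 'M[R]_n.+1) (lam : 'rV[R]_n.+1) (s : 'S_n.+1).

(** The relations of a frame, differentiated: Q Q^T = 1, the shapes of L and U, Q = L U, and T = Q M
    Q^T. Here [dT] and [dZ] are the derivatives of Y + D and Z + D, and the last equation
    differentiates L (Z + D) = (Y + D) L, which involves no inverse of L. *)
Definition frame_derivative M Q L U dM dQ dL dU dT dZ :=
  [/\ dQ *m Q^T + Q *m dQ^T = 0, is_trig_mx dL, forall i, dL i i = 0,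
      is_trig_mx dU^T & dQ = dL *m U + L *m dU] /\
  [/\ is_trig_mx dT, dT = (dQ *m M + Q *m dM) *m Q^T + Q *m M *m dQ^T &
      dL *m (U *m M *m invmx U) + L *m dZ = dT *m L + Q *m M *m Q^T *m dL].

Lemma skew_trig0 S : S^T = - S -> is_trig_mx S -> S = 0.
Proof.
move=> sS /is_trig_mxP tS; have sE i j : S j i = - S i j.
  by have /matrixP/(_ i j) := sS; rewrite !mxE.
apply/matrixP => i j; rewrite mxE; case: (ltngtP i j) => [/tS //|/tS ji|/val_inj <-].
  by rewrite sE ji oppr0.
by apply/eqP; rewrite -eqNr -sE.
Qed.

Section Frame.
Variables (s : 'S_n.+1) (M : 'M[R]_n.+1) (lam : 'rV[R]_n.+1) (Q L U : 'M[R]_n.+1).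
Variables dM dQ dL dU dT dZ : 'M[R]_n.+1.
Hypothesis fr : frame s M lam Q L U.
Hypothesis fd : frame_derivative M Q L U dM dQ dL dU dT dZ.

Let T := Q *m M *m Q^T.
Let Z := U *m M *m invmx U.
Let N := invmx L *m dL.

Let oQ : Opos Q. Proof. by case: fr => -[]. Qed.
Let lL : Lo1 L. Proof. by case: fr => -[]. Qed.
Let uU : Uppos U. Proof. by case: fr => -[]. Qed.
Let QE : Q = L *m U. Proof. by case: fr => -[]. Qed.
Let uL := Lo1_unit lL.
Let uU' := Uppos_unit uU.

Let tT : is_trig_mx T. Proof. by case: fr => _ []. Qed.
Let tZ : is_trig_mx Z. Proof. by case: fr => _ []. Qed.

Let dTneq i j : i != j -> T i i != T j j.
Proof.
move=> ij; case: fr => -[sd _ _ _ _] [_ dT' _ _].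
by rewrite /T !dT'; apply: sd_neq; rewrite ?(inj_eq perm_inj).
Qed.

Let dZneq i j : i != j -> Z i i != Z j j.
Proof.
move=> ij; case: fr => -[sd _ _ _ _] [_ _ _ dZ'].
by rewrite /Z !dZ'; apply: sd_neq; rewrite ?(inj_eq perm_inj).
Qed.

Let ZE : Z = invmx L *m T *m L.
Proof. exact: lu_conj. Qed.

Let tN : is_trig_mx N.
Proof. by case: fd => -[_ tdL _ _ _] _; rewrite trig_mulmx // trig_invmx //; case: lL. Qed.

Let dN i : N i i = 0.
Proof.
case: fd => -[_ tdL dL0 _ _] _; rewrite /N trig_mulmx_diag ?dL0 ?mulr0 //.
by rewrite trig_invmx //; case: lL.
Qed.

Let dZE : dT = 0 -> dZ = Z *m N - N *m Z.
Proof.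
case: fd => _ [_ _ E] dT0; rewrite -/Z -/T dT0 mul0mx add0r in E.
apply: (addrI (N *m Z)); rewrite [RHS]addrC subrK.
rewrite /N -mulmxA -[dZ in LHS](mulKmx uL) -mulmxDr E {1}ZE.
by rewrite -!mulmxA [L *m (invmx L *m _)]mulKVmx.
Qed.

(** When [dT] and [dZ] vanish, the strictly lower N = L^-1 dL commutes with a triangular matrix with
    distinct diagonal entries, so N = 0 and dL = 0. *)
Lemma frame_derivative_inj : dT = 0 -> dZ = 0 -> dM = 0.
Proof.
move=> dT0 dZ0; have N0 : N = 0.
  apply: (strict_trig_comm0 tZ) => //.
  by have := dZE dT0; rewrite dZ0 => /esym/eqP; rewrite subr_eq0 => /eqP.
have dL0 : dL = 0 by rewrite -(mulKVmx uL dL) -/N N0 mulmx0.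
case: fd => -[sk _ _ tdU dQE] [_ dTE _].
have dQE' : Q^T *m dQ = invmx U *m dU.
  by rewrite dQE dL0 mul0mx add0r (Uppos_invmx oQ lL uU QE) mulmxA.
have dQ0 : Q^T *m dQ = 0.
  apply: trmx_inj; rewrite trmx0; apply: skew_trig0.
    rewrite !trmx_mul !trmxK; apply/eqP; rewrite -addr_eq0; apply/eqP.
    have := congr1 (fun A => Q^T *m A *m Q) sk.
    rewrite mulmxDr mulmxDl mulmx0 mul0mx !mulmxA (proj1 oQ) mul1mx.
    by rewrite -mulmxA (proj1 oQ) mulmx1 => <-.
  rewrite dQE' trmx_mul trig_mulmx // trmx_inv trig_invmx //.
  by case: uU.
have {}dQ0 : dQ = 0.
  by rewrite -[dQ]mul1mx -(Opos_trmx oQ) -mulmxA dQ0 mulmx0.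
move: dTE; rewrite dT0 dQ0 trmx0 mulmx0 addr0 mul0mx add0r => E.
have uQ := Opos_unit oQ.
have := congr1 (fun A => Q^T *m A *m Q) E.
rewrite mulmx0 mul0mx !mulmxA (proj1 oQ) mul1mx -mulmxA (proj1 oQ) mulmx1.
by move=> <-.
Qed.

Variable p : {poly R}.
Hypothesis dME : dM = toda p M.

Let Ao := Pi_o (horner_mx M p).

(** S = dQ Q^T - Q Ao Q^T is skew and satisfies dT = S T - T S. Since dT is lower triangular,
    [trig_sylvester] makes S lower triangular, and a skew lower triangular matrix is zero. *)
Let flow_Q : dQ = Q *m Ao /\ dT = 0.
Proof.
case: fd => -[sk _ _ _ _] [tdT dTE _].
pose K := dQ *m Q^T; pose A' := Q *m Ao *m Q^T; pose S := K - A'.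
have dQK : dQ = K *m Q by rewrite /K -mulmxA (proj1 oQ) mulmx1.
have KT : K^T = - K.
  by apply/eqP; rewrite -addr_eq0 addrC /K trmx_mul trmxK sk.
have [skA _] := Pi_oP (horner_mx M p).
have ST : S^T = - S.
  rewrite /S linearB /= KT opprB addrC; congr (_ + _); rewrite /A' !trmx_mul trmxK.
  by rewrite (_ : Ao^T = - Ao) ?mulNmx ?mulmxN ?opprK ?mulmxA //.
have dTS : dT = S *m T - T *m S.
  rewrite dTE dME /toda /bracket -/Ao mulmxDl mulmxBr mulmxBl.
  have -> : dQ *m M *m Q^T = K *m T by rewrite dQK /T !mulmxA.
  have -> : Q *m M *m dQ^T = - (T *m K).
    rewrite -mulmxN -KT /T {1}dQK trmx_mul -!mulmxA; congr (_ *m (_ *m _)).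
  have -> : Q *m (M *m Ao) *m Q^T = T *m A'.
    by rewrite /T /A' !mulmxA -[_ *m Q^T *m Q]mulmxA (proj1 oQ) mulmx1.
  have -> : Q *m (Ao *m M) *m Q^T = A' *m T.
    by rewrite /T /A' !mulmxA -[_ *m Q^T *m Q]mulmxA (proj1 oQ) mulmx1.
  rewrite /S mulmxBl mulmxBr opprB.
  move: (K *m T) (A' *m T) (T *m A') (T *m K) => W1 W2 W3 W4.
  by apply/matrixP => a b; rewrite !mxE; ring.
have S0 : S = 0.
  apply: skew_trig0 => //; apply: (trig_sylvester tT tT); last by rewrite -dTS.
  by move=> i j ij; apply: dTneq; rewrite ord_neq_ltn ij.
split; last by rewrite dTS S0 mul0mx mulmx0 subrr.
by rewrite dQK -[K](subrK A') -/S S0 add0r /A' -mulmxA (proj1 oQ) mulmx1.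
Qed.

Lemma frame_flow_T : dT = 0.
Proof. by case: flow_Q. Qed.

(** N + dU U^-1 = U Ao U^-1 differs from p(Z) = U p(M) U^-1 by an upper triangular matrix, so N is
    the strictly lower part p(Z) - Dp. As p(Z) commutes with Z, the commutator of Z and N reduces to
    Dp Z - Z Dp. *)
Lemma frame_flow_Z i j : dZ i j = (p.[Z i i] - p.[Z j j]) * Z i j.
Proof.
have [dQA dT0] := flow_Q; have [tpZ dpZ] := horner_mx_trig p tZ.
set pZ := horner_mx Z p in tpZ dpZ; pose Dp := diag_mx (\row_i p.[Z i i]).
case: fd => -[_ _ _ tdU dQE] _; have [_ upB] := Pi_oP (horner_mx M p).
have UE : U = invmx L *m Q by rewrite QE mulKmx.
have UM : U *m M = Z *m U by rewrite /Z mulmxKV.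
have NU : N + dU *m invmx U = U *m Ao *m invmx U.
  have : N *m U + dU = U *m Ao.
    by rewrite [in RHS]UE -[RHS]mulmxA -dQA dQE mulmxDr mulKmx // mulmxA.
  by move=> <-; rewrite mulmxDl mulmxK.
have pZE : pZ = U *m horner_mx M p *m invmx U.
  by rewrite (horner_mx_intertwine _ UM) mulmxK.
have upN : is_trig_mx (N - pZ)^T.
  have -> : N - pZ = - (U *m (horner_mx M p - Ao) *m invmx U) - dU *m invmx U.
    by rewrite mulmxBr mulmxBl -pZE -NU opprB addrAC addrK.
  rewrite linearB linearN /= trigB ?trigN // !trmx_mul ?trig_mulmx //;
  by rewrite ?trmx_inv ?trig_invmx //; case: uU.
have NE : N = pZ - Dp.
  apply/eqP; rewrite -subr_eq0; apply/eqP/matrixP => a b; rewrite [RHS]mxE.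
  have tW : is_trig_mx (N - (pZ - Dp)) by rewrite !trigB // diag_mx_is_trig.
  case: (eqVneq a b) => [<-|ab].
    rewrite [LHS]mxE dN add0r [LHS]mxE [(pZ - _) a a]mxE dpZ [(- Dp) a a]mxE.
    have -> : Dp a a = p.[Z a a] by rewrite [LHS]mxE eqxx mulr1n [LHS]mxE.
    by rewrite subrr oppr0.
  apply: trig_diag => //; rewrite opprB addrA addrAC linearD /= trigD //.
  by rewrite tr_diag_mx diag_mx_is_trig.
have cZ : Z *m pZ = pZ *m Z by exact: horner_mx_intertwine.
have DZ : (Dp *m Z) i j = p.[Z i i] * Z i j by rewrite mul_diag_mx [LHS]mxE; congr (_ * _); rewrite [LHS]mxE.
have ZD : (Z *m Dp) i j = Z i j * p.[Z j j] by rewrite mul_mx_diag [LHS]mxE; congr (_ * _); rewrite [LHS]mxE.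
rewrite dZE // NE mulmxBr mulmxBl cZ opprB addrC subrKA.
by rewrite [LHS]mxE [(- (Z *m Dp)) i j]mxE DZ ZD mulrBl [Z i j * _]mulrC.
Qed.

End Frame.
End FrameDerivative.

(** * Frames along curves *)

Section Curves.
Context {R : realType}.

Lemma is_derive_near_cst (f : R -> R) (t c d : R) :
  (\forall u \near t, f u = c) -> is_derive t (1 : R) f d -> d = 0.
Proof.
move=> fc [_ <-]; by rewrite (near_eq_derive (1 : R) (g := cst c)) ?derive_cst.
Qed.

Lemma curve_near (V : normedModType R) (g : R -> V) (t : R) (v : V) (Om : set V) :
  open Om -> Om (g t) -> is_derive t (1 : R) g v -> \forall u \near t, Om (g u).
Proof.
move=> oOm Ot [/derivable1_diffP/differentiable_continuous cg _].
by apply: cg; exact: open_nbhs_nbhs.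
Qed.

Lemma zero_derive_interval_cst (J : set R) (f : R -> R) : is_interval J ->
  (forall t, J t -> is_derive t (1 : R) f 0) ->
  forall t u, J t -> J u -> f t = f u.
Proof.
move=> iJ df t u; wlog tu : t u / t <= u.
  by move=> H Jt Ju; case: (leP t u) => [|/ltW] tu; [|symmetry]; apply: H.
move=> Jt Ju; have Jx x : t <= x <= u -> J x by exact: iJ.
have [x|x|c _] := @MVT_segment R f (fun=> 0) t u tu.
- by rewrite in_itv /= => /andP[/ltW tx /ltW xu]; apply/df/Jx; rewrite tx.
- apply: (@derivable_within_continuous _ _ f `[t, u]) => y.
  by rewrite in_itv /= => /Jx/df[].
- by rewrite mul0r => /eqP; rewrite subr_eq0 => /eqP ->.
Qed.

End Curves.

Section FrameCurve.
Context {R : realType} {n : nat}.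
Implicit Types (M Q L U : 'M[R]_n.+1) (s : 'S_n.+1) (g : R -> 'M[R]_n.+1).

Lemma mxCk_curve (Om : set 'M[R]_n.+1) (F : 'M[R]_n.+1 -> 'M[R]_n.+1) g t v :
  mxCk Om 1 F -> Om (g t) -> is_derive t (1 : R) g v ->
  is_derive t (1 : R) (fun u => F (g u)) (\matrix_(i, j) 'd (fun M => F M i j) (g t) v).
Proof.
move=> CF Ot dg; apply/is_derive_mxP => i j; rewrite mxE.
have [dF _] := CF i j; have := dF _ Ot => {}dF.
exact: (is_derive_comp_curve dF dg).
Qed.

Lemma lv_UGL s M : UGL s M ->
  [/\ forall i, lvD s M i i = eigs M 0 (s i), forall i j, i != j -> lvD s M i j = 0,
      forall i j : 'I_n.+1, (i <= j)%N -> lvY s M i j = 0 &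
      forall i j : 'I_n.+1, (i <= j)%N -> lvZ s M i j = 0].
Proof.
move=> UM; have [Om [Q [L [U [[_ OM _] [_ _ _ /(_ _ OM) fr]]]]]] := smooth_frame UM.
have lvE := frame_linearizing fr; case: fr => _ [/is_trig_mxP tT dT /is_trig_mxP tZ dZ].
rewrite lvDE //; split.
- by move=> i; rewrite diag_permEii.
- by move=> i j ij; rewrite mxE (negPf ij).
- move=> i j; rewrite /lvY lvE /= [LHS]mxE [(- diag_perm _ _) i j]mxE leq_eqVlt.
  move=> /orP[/eqP/val_inj <-|ij]; first by rewrite dT diag_permEii subrr.
  by rewrite tT // !mxE -val_eqE ltn_eqF // subrr.
- move=> i j; rewrite /lvZ lvE /= [LHS]mxE [(- diag_perm _ _) i j]mxE leq_eqVlt.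
  move=> /orP[/eqP/val_inj <-|ij]; first by rewrite dZ diag_permEii subrr.
  by rewrite tZ // !mxE -val_eqE ltn_eqF // subrr.
Qed.

(** Each relation of [frame_derivative] is an identity valid along the curve near t, differentiated
    at t. Entries that are constant near t have derivative 0, which makes [Dd] diagonal and [Yd],
    [Zd] strictly lower triangular. *)
Lemma curve_frame s g t dM : UGL s (g t) -> is_derive t (1 : R) g dM ->
  exists Q L U dQ dL dU Dd Yd Zd,
  [/\ frame s (g t) (eigs (g t)) Q L U,
      frame_derivative (g t) Q L U dM dQ dL dU (Dd + Yd) (Dd + Zd),
      lvD s (g t) + lvZ s (g t) = U *m g t *m invmx U &
    [/\ is_derive t (1 : R) (fun u => lvD s (g u)) Dd,
        is_derive t (1 : R) (fun u => lvY s (g u)) Yd,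
        is_derive t (1 : R) (fun u => lvZ s (g u)) Zd,
        (forall i j : 'I_n.+1, (i <= j)%N -> Yd i j = 0 /\ Zd i j = 0) &
        (forall i j : 'I_n.+1, i != j -> Dd i j = 0)]].
Proof.
move=> Ut dg; have oU : open (UGL s : set 'M[R]_n.+1) by exact: UGL_open.
have [Om [Q [L [U [[oOm Ot sOm] [CQ CL CU fr]]]]]] := smooth_frame Ut.
have nO : \forall u \near t, Om (g u).
  exact: (@curve_near _ _ _ _ _ Om oOm Ot dg).
have nU : \forall u \near t, @UGL R n s (g u).
  exact: (@curve_near _ _ _ _ _ (UGL s) oU Ut dg).
have := @lvYZ_mxCk R n 1 s; case=> CY CZ; have CD := @lvD_mxCk R n 1 s.
have HD := mxCk_curve CD Ut dg; have HY := mxCk_curve CY Ut dg.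
have HZ := mxCk_curve CZ Ut dg.
have HQ := mxCk_curve (CQ 1) Ot dg; have HL := mxCk_curve (CL 1) Ot dg.
have HU := mxCk_curve (CU 1) Ot dg.
set dQ := (X in is_derive _ _ _ X) in HQ; set dL := (X in is_derive _ _ _ X) in HL.
set dU := (X in is_derive _ _ _ X) in HU; set Dd := (X in is_derive _ _ _ X) in HD.
set Yd := (X in is_derive _ _ _ X) in HY; set Zd := (X in is_derive _ _ _ X) in HZ.
have lvE M : Om M -> lvD s M + lvY s M = Q M *m M *m (Q M)^T /\
    lvD s M + lvZ s M = U M *m M *m invmx (U M).
  by move=> /fr/frame_linearizing lvE; rewrite /lvD /lvY /lvZ lvE /= ![diag_perm _ _ + _]addrC !subrK.
have YZ0 (i j : 'I_n.+1) : (i <= j)%N -> Yd i j = 0 /\ Zd i j = 0.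
  move=> ij; split.
    apply: (is_derive_near_cst (c := 0)) ((is_derive_mxP _ _ _ _).1 HY i j).
    near=> u; have Uu : UGL s (g u) by near: u.
    by have [_ _ -> //] := lv_UGL Uu.
  apply: (is_derive_near_cst (c := 0)) ((is_derive_mxP _ _ _ _).1 HZ i j).
  near=> u; have Uu : UGL s (g u) by near: u.
  by have [_ _ _ -> //] := lv_UGL Uu.
have D0 (i j : 'I_n.+1) : i != j -> Dd i j = 0.
  move=> ij; apply: (is_derive_near_cst (c := 0)) ((is_derive_mxP _ _ _ _).1 HD i j).
  near=> u; have Uu : UGL s (g u) by near: u.
  by have [_ -> //] := lv_UGL Uu.
have HT := is_derive_mulmx (is_derive_mulmx HQ dg) (is_derive_trmx HQ).
have TE : Dd + Yd = (dQ *m g t + Q (g t) *m dM) *m (Q (g t))^T + Q (g t) *m g t *m dQ^T.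
  apply: is_derive_mx_near (is_deriveD HD HY) HT.
  near=> u; have Ou : Om (g u) by near: u.
    by have [<- _] := lvE _ Ou.
exists (Q (g t)), (L (g t)), (U (g t)), dQ, dL, dU, Dd, Yd, Zd; split=> //.
- exact: fr.
- split; split.
  + have H := is_derive_mulmx HQ (is_derive_trmx HQ).
    apply: is_derive_mx_near H (is_derive_cst (1%:M : 'M[R]_n.+1) t 1).
    near=> u; have Ou : Om (g u) by near: u.
    by have [[_ oQ _ _ _] _] := fr _ Ou; rewrite Opos_trmx.
  + apply/is_trig_mxP => i j ij.
    apply: (is_derive_near_cst (c := 0)) ((is_derive_mxP _ _ _ _).1 HL i j).
    near=> u; have Ou : Om (g u) by near: u.
    by have [[_ _ [/is_trig_mxP tL _] _ _] _] := fr _ Ou; exact: tL.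
  + move=> i; apply: (is_derive_near_cst (c := 1)) ((is_derive_mxP _ _ _ _).1 HL i i).
    near=> u; have Ou : Om (g u) by near: u.
    by have [[_ _ [_ ->] _ _] _] := fr _ Ou.
  + apply/is_trig_mxP => i j ij; rewrite mxE.
    apply: (is_derive_near_cst (c := 0)) ((is_derive_mxP _ _ _ _).1 HU j i).
    near=> u; have Ou : Om (g u) by near: u.
    have [[_ _ _ [/is_trig_mxP tU _] _] _] := fr _ Ou.
    by have := tU i j ij; rewrite mxE.
  + apply: is_derive_mx_near HQ (is_derive_mulmx HL HU).
    near=> u; have Ou : Om (g u) by near: u.
    by have [[_ _ _ _ ->] _] := fr _ Ou.
  + apply/is_trig_mxP => i j ij; rewrite mxE D0 ?add0r; last by rewrite ord_neq_ltn ij.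
    by case: (YZ0 i j (ltnW ij)).
  + exact: TE.
  + have [_ <-] := lvE _ Ot; rewrite TE.
    apply: is_derive_mx_near (is_derive_mulmx HL (is_deriveD HD HZ)) (is_derive_mulmx HT HL).
    near=> u; have Ou : Om (g u) by near: u.
    have [_ DZE] := lvE _ Ou; have [[_ oQ lL uU QE] _] := fr _ Ou.
    transitivity (L (g u) *m (lvD s (g u) + lvZ s (g u))); first by [].
    by rewrite DZE (lu_conj _ oQ lL uU QE) !mulmxA mulmxV ?mul1mx // Lo1_unit.
- by have [_] := lvE _ Ot.
Unshelve. all: by end_near. Qed.

End FrameCurve.

(** * The flow in linearizing variables *)

(** A monotone p with p(a) = p(b) is constant between a and b, so p - p(a) has too many roots. *)
Lemma monotone_poly_inj (R : realFieldType) (p : {poly R}) (a b : R) :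
  (1 < size p)%N ->
  {homo (fun x : R => p.[x]) : x y / x <= y} \/ {homo (fun x : R => p.[x]) : x y /~ x <= y} ->
  a != b -> p.[a] != p.[b].
Proof.
move=> sp mono; wlog ab : a b / a < b.
  move=> H ab; case: (ltgtP a b) ab => // [ab _|ba _]; first by apply: H; rewrite // lt_eqF.
  by rewrite eq_sym; apply: H; rewrite // lt_eqF.
move=> _; apply/eqP => pab.
have cst x : a <= x <= b -> p.[x] = p.[a].
  move=> /andP[ax xb]; apply/le_anti/andP.
  case: mono => mono; split; first by rewrite pab mono.
  - exact: mono.
  - exact: mono.
  - by rewrite pab mono.
pose q := p - p.[a]%:P.
have sq : size q = size p by rewrite size_polyDl // size_polyN (leq_ltn_trans (size_polyC_leq1 _)).
have q0 : q != 0 by rewrite -size_poly_gt0 sq (ltn_trans _ sp).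
(* Distinct points of the interval from a to b, as many as the size of q, which is one more than its
   degree. *)
pose rs := [seq a + (b - a) / k.+1%:R | k <- iota 0 (size q)].
have : (size rs < size q)%N.
  apply: max_poly_roots => //.
    apply/allP => _ /mapP[k _ ->]; rewrite rootE !hornerE cst ?subrr //.
    have ba : 0 <= b - a by rewrite subr_ge0 ltW.
    rewrite lerDl divr_ge0 //= -lerBrDl ler_pdivrMr ?ltr0n //.
    by rewrite ler_peMr // ler1n.
  rewrite map_inj_uniq ?iota_uniq // => k l /addrI /mulfI.
  rewrite subr_eq0 gt_eqF // => /(_ isT) /invr_inj /eqP.
  by rewrite eqr_nat => /eqP[].
by rewrite size_map size_iota ltnn.
Qed.

Section RealDerivatives.
Context {R : realType}.
Implicit Types (f g : R -> R) (t : R).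

Lemma is_derive_mulr f g t df dg : is_derive t (1 : R) f df -> is_derive t (1 : R) g dg ->
  is_derive t (1 : R) (fun u => f u * g u) (df * g t + f t * dg).
Proof.
move=> Hf Hg; apply: (is_derive_eq (is_deriveM Hf Hg)).
by rewrite addrC; congr (_ + _); exact: mulrC.
Qed.

Lemma is_derive_invr g t dg : g t != 0 -> is_derive t (1 : R) g dg ->
  is_derive t (1 : R) (fun u => (g u)^-1) (- (g t) ^- 2 * dg).
Proof.
move=> g0 [Dg Eg]; split; first exact: derivableV.
by rewrite deriveV // Eg.
Qed.

Lemma is_derive_compr (h : R -> R) (h' : R) f t df :
  is_derive (f t) (1 : R) h h' -> is_derive t (1 : R) f df ->
  is_derive t (1 : R) (fun u => h (f u)) (h' * df).
Proof. by move=> Hh Hf; exact: (is_derive1_comp Hh Hf). Qed.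

End RealDerivatives.

Section Flow.
Context {R : realType} {n : nat}.
Implicit Types (M : 'M[R]_n.+1) (s : 'S_n.+1) (g : R -> 'M[R]_n.+1) (p : {poly R}).

(** The derivative of Y + D is zero, and its diagonal and strictly lower parts vanish separately;
    once D is constant, the derivative of Z + D is that of Z. *)
Lemma toda_lv p s g t : UGL s (g t) -> is_derive t (1 : R) g (toda p (g t)) ->
  [/\ is_derive t (1 : R) (fun u => lvD s (g u)) 0,
      is_derive t (1 : R) (fun u => lvY s (g u)) 0 &
      forall i j : 'I_n.+1, (j < i)%N -> is_derive t (1 : R) (fun u => lvZ s (g u) i j)
        (pgap p s (g t) i j * lvZ s (g t) i j)].
Proof.
move=> Ut dg.
have [Q [L [U [dQ [dL [dU [Dd [Yd [Zd [fr fd ZE [HD HY HZ YZ0 D0]]]]]]]]]]] := curve_frame Ut dg.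
have DY0 := frame_flow_T fr fd erefl.
have Dii i j : Dd i j = 0.
  case: (eqVneq i j) => [<-|/D0 //].
  by have /matrixP/(_ i i) := DY0; rewrite !mxE (proj1 (YZ0 i i (leqnn i))) addr0.
have Dd0 : Dd = 0 by apply/matrixP => i j; rewrite Dii mxE.
have Yd0 : Yd = 0 by move: DY0; rewrite Dd0 add0r.
split; [by rewrite -Dd0|by rewrite -Yd0|move=> i j ji].
apply: (is_derive_eq ((is_derive_mxP _ _ _ _).1 HZ i j)).
have := frame_flow_Z fr fd erefl i j; rewrite -ZE Dd0 add0r => ->.
have [_ Dij _ Zij] := lv_UGL Ut.
have E k : (lvD s (g t) + lvZ s (g t)) k k = lvD s (g t) k k.
  by rewrite mxE Zij ?addr0.
have ij : i != j by rewrite ord_neq_ltn ji orbT.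
by rewrite !E [(lvD _ _ + _) i j]mxE (Dij _ _ ij) add0r.
Qed.

Lemma lv_curve_inj s g t v : UGL s (g t) -> is_derive t (1 : R) g v ->
  is_derive t (1 : R) (fun u => lvD s (g u)) 0 ->
  is_derive t (1 : R) (fun u => lvY s (g u)) 0 ->
  is_derive t (1 : R) (fun u => lvZ s (g u)) 0 -> v = 0.
Proof.
move=> Ut dg [_ D0] [_ Y0] [_ Z0].
have [Q [L [U [dQ [dL [dU [Dd [Yd [Zd [fr fd ZE [[_ HD] [_ HY] [_ HZ] _ _]]]]]]]]]]] :=
  curve_frame Ut dg.
by apply: (frame_derivative_inj fr fd); rewrite -HD -?HY -?HZ D0 ?Y0 ?Z0 addr0.
Qed.

Lemma pgap_neq0 p s M i j : (1 < size p)%N ->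
  {homo (fun x : R => p.[x]) : x y / x <= y} \/ {homo (fun x : R => p.[x]) : x y /~ x <= y} ->
  UGL s M -> i != j -> pgap p s M i j != 0.
Proof.
move=> sp mono UM ij; rewrite subr_eq0; apply: monotone_poly_inj => //.
have [D _ _ _] := lv_UGL UM; rewrite !D; have [sd _] := UGL_simple UM.
by apply: sd_neq; rewrite ?(inj_eq perm_inj).
Qed.

Lemma is_derive_pgap p s g t i j : is_derive t (1 : R) (fun u => lvD s (g u)) 0 ->
  is_derive t (1 : R) (fun u => pgap p s (g u) i j) 0.
Proof.
move=> HD; have H k : is_derive t (1 : R) (fun u => p.[lvD s (g u) k k]) 0.
  have := (is_derive_mxP _ _ _ _).1 HD k k; rewrite mxE => Hk.
  apply: (is_derive_eq (is_derive_compr (is_derive_poly p _) Hk)).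
  by rewrite mulr0.
apply: (is_derive_eq (is_deriveB (H i) (H j))); exact: subrr.
Qed.

End Flow.

(** * The variables w and super-integrability *)

Section WVariables.
Context {R : realType} {n : nat}.
Variables (s : 'S_n.+1) (i0 j0 : 'I_n.+1) (sigma : R) (p : {poly R}).
Hypothesis hij0 : (j0 < i0)%N.
Hypothesis hsigma : sigma = 1 \/ sigma = -1.
Hypothesis hp : (1 < size p)%N.
Hypothesis hmono : {homo (fun x : R => p.[x]) : x y / x <= y} \/
  {homo (fun x : R => p.[x]) : x y /~ x <= y}.

Let H : set 'M[R]_n.+1 := Hset s i0 j0 sigma.

Let HU M : H M -> UGL s M. Proof. by case. Qed.

Let oU : open (UGL s : set 'M[R]_n.+1). Proof. exact: UGL_open. Qed.

Lemma Hset_open : open (Hset s i0 j0 sigma).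
Proof.
rewrite openE => M0; case=> U0 Z0.
have [_ CZ] := @lvYZ_mxCk R n 0 s.
have cz : {for M0, continuous (fun M => sigma * lvZ s M i0 j0)}.
  by apply: (@Ck_continuous _ _ 0 (UGL s)) => //; apply: CkM => //; exact: Ck_cst.
suff : \forall M \near M0, H M by [].
have nU : \forall M \near M0, @UGL R n s M by exact: (open_nbhs_nbhs (conj oU U0)).
have nZ := near_gt0 cz Z0.
by near=> M; split; near: M.
Unshelve. all: by end_near. Qed.

(** On the set H the absolute value of z_i0j0 is sigma z_i0j0, so this is its logarithm without the
    absolute value; the power in [w] becomes an exponential of it. *)
Definition lz (M : 'M[R]_n.+1) := ln (sigma * lvZ s M i0 j0).
Definition gap0 (M : 'M[R]_n.+1) := pgap p s M i0 j0.

Let ij0 : i0 != j0. Proof. by rewrite ord_neq_ltn hij0 orbT. Qed.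

Lemma gap0_neq0 M : H M -> gap0 M != 0.
Proof. by move=> /HU UM; exact: pgap_neq0. Qed.

Lemma sigma_sqr : sigma * sigma = 1.
Proof. by case: hsigma => ->; rewrite ?mulr1 // mulrNN mulr1. Qed.

Lemma normZ M : H M -> `|lvZ s M i0 j0| = sigma * lvZ s M i0 j0.
Proof.
move=> [_ z0]; rewrite -[RHS]gtr0_norm // normrM.
by case: hsigma => ->; rewrite ?normrN normr1 mul1r.
Qed.

Lemma w0E M : H M -> w0 p s i0 j0 M = lz M / gap0 M.
Proof. by move=> HM; rewrite /w0 normZ. Qed.

Lemma wE i j M : H M ->
  w p s i0 j0 i j M = lvZ s M i j * expR (- (eps p s i0 j0 i j M * lz M)).
Proof.
move=> HM; rewrite /w normZ // /powR gt_eqF; last by case: HM.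
by rewrite expRN.
Qed.

Lemma lz_w0 M : H M -> lz M = w0 p s i0 j0 M * gap0 M.
Proof. by move=> HM; rewrite w0E // divfK // gap0_neq0. Qed.

Lemma Z0_w0 M : H M -> lvZ s M i0 j0 = sigma * expR (w0 p s i0 j0 M * gap0 M).
Proof.
move=> HM; rewrite -lz_w0 // /lz lnK; last by rewrite posrE; case: HM.
by rewrite mulrA sigma_sqr mul1r.
Qed.

(** With [Z0_w0], the inverse of the change of variables from Z to w at fixed D: the exponent eps_ij
    [lz] equals w0 times the gap of (i, j). *)
Lemma Z_w i j M : H M -> lvZ s M i j =
  w p s i0 j0 i j M * expR (w0 p s i0 j0 M * pgap p s M i j).
Proof.
move=> HM; rewrite wE // lz_w0 // /eps -/(gap0 M) -mulrA -expRD.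
have g0 := gap0_neq0 HM; set a := pgap _ _ _ _ _.
have -> : a / gap0 M * (w0 p s i0 j0 M * gap0 M) = w0 p s i0 j0 M * a by field.
by rewrite addNr expR0 mulr1.
Qed.

Section Curve.
Variables (g : R -> 'M[R]_n.+1) (t : R) (v : 'M[R]_n.+1).
Hypothesis Ht : H (g t).
Hypothesis dg : is_derive t (1 : R) g v.
Hypothesis HD : is_derive t (1 : R) (fun u => lvD s (g u)) 0.

Let nH : \forall u \near t, H (g u).
Proof. exact: (@curve_near _ _ _ _ _ H Hset_open Ht dg). Qed.

Let Dgap i j : is_derive t (1 : R) (fun u => pgap p s (g u) i j) 0.
Proof. exact: is_derive_pgap. Qed.

Let g0 : gap0 (g t) != 0. Proof. exact: gap0_neq0. Qed.

Let Vgap0 : is_derive t (1 : R) (fun u => (gap0 (g u))^-1) 0.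
Proof.
have D0 : is_derive t (1 : R) (fun u => gap0 (g u)) 0 by exact: Dgap.
by apply: (is_derive_eq (is_derive_invr (g := fun u => gap0 (g u)) g0 D0)); rewrite mulr0.
Qed.

Lemma is_derive_eps i j : is_derive t (1 : R) (fun u => eps p s i0 j0 i j (g u)) 0.
Proof.
apply: (is_derive_eq (is_derive_mulr (Dgap i j) Vgap0)).
by rewrite mul0r mulr0 addr0.
Qed.

Hypothesis HZ : forall i j : 'I_n.+1, (j < i)%N ->
  is_derive t (1 : R) (fun u => lvZ s (g u) i j) (pgap p s (g t) i j * lvZ s (g t) i j).

Lemma is_derive_lz : is_derive t (1 : R) (fun u => lz (g u)) (gap0 (g t)).
Proof.
have [_ z0] := Ht; have Hs := is_derive_cst sigma t (1 : R).
apply: (is_derive_eq (is_derive_compr (f := fun u => sigma * lvZ s (g u) i0 j0)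
  (is_derive1_ln z0) (is_derive_mulr Hs (HZ hij0)))).
have zn : sigma * lvZ s (g t) i0 j0 != 0 by rewrite gt_eqF.
apply: (mulfI zn); rewrite mul0r add0r (mulVKf zn) /= /gap0; ring.
Qed.

Lemma is_derive_w0 : is_derive t (1 : R) (fun u => w0 p s i0 j0 (g u)) (1 : R).
Proof.
apply: (@near_eq_is_derive _ _ _ (fun u => lz (g u) * (gap0 (g u))^-1)).
  by near=> u; rewrite w0E //; near: u.
apply: (is_derive_eq (is_derive_mulr is_derive_lz Vgap0)).
by rewrite mulr0 addr0 mulfV.
Unshelve. all: by end_near. Qed.

(** The growth rate of z_ij is its gap, and that of the power of |z_i0j0| is eps_ij times the gap of
    (i0, j0), which is the same number. *)
Lemma is_derive_w (i j : 'I_n.+1) : (j < i)%N ->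
  is_derive t (1 : R) (fun u => w p s i0 j0 i j (g u)) (0 : R).
Proof.
move=> ji; apply: (@near_eq_is_derive _ _ _
   (fun u => lvZ s (g u) i j * expR (- (eps p s i0 j0 i j (g u) * lz (g u))))).
  by near=> u; rewrite wE //; near: u.
have He := is_deriveN (is_derive_mulr (is_derive_eps i j) is_derive_lz).
apply: (is_derive_eq (is_derive_mulr (HZ ji)
  (is_derive_compr (is_derive_expR _) He))).
rewrite mul0r add0r /eps -/(gap0 _) divfK //; ring.
Unshelve. all: by end_near. Qed.

End Curve.

Lemma is_derive_lvZ0 (g : R -> 'M[R]_n.+1) t v : H (g t) -> is_derive t (1 : R) g v ->
  is_derive t (1 : R) (fun u => lvD s (g u)) 0 ->
  is_derive t (1 : R) (fun u => w0 p s i0 j0 (g u)) (0 : R) ->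
  (forall i j : 'I_n.+1, (j < i)%N -> (i, j) <> (i0, j0) ->
     is_derive t (1 : R) (fun u => w p s i0 j0 i j (g u)) (0 : R)) ->
  is_derive t (1 : R) (fun u => lvZ s (g u)) 0.
Proof.
move=> Ht dg HD Hw0 Hw; apply/is_derive_mxP => i j; rewrite mxE.
have nH : \forall u \near t, H (g u) by exact: (@curve_near _ _ _ _ _ H Hset_open Ht dg).
case: (leqP i j) => ij.
  apply: (@near_eq_is_derive _ _ _ (cst 0)).
    near=> u; have Hu : H (g u) by near: u.
    by have [_ _ _ ->] := lv_UGL (HU Hu).
have Hexp a b : is_derive t (1 : R) (fun u => expR (w0 p s i0 j0 (g u) * pgap p s (g u) a b)) 0.
  apply: (is_derive_eq (is_derive_compr (is_derive_expR _)
    (is_derive_mulr Hw0 (is_derive_pgap p a b HD)))).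
  by rewrite mul0r !mulr0 addr0 mulr0.
have [[-> ->]|/eqP neq] := eqVneq (i, j) (i0, j0).
  apply: (@near_eq_is_derive _ _ _
    (fun u => sigma * expR (w0 p s i0 j0 (g u) * pgap p s (g u) i0 j0))).
    by near=> u; rewrite Z0_w0 //; near: u.
  apply: (is_derive_eq (is_derive_mulr (is_derive_cst sigma t (1 : R)) (Hexp i0 j0))).
  by rewrite mul0r mulr0 addr0.
apply: (@near_eq_is_derive _ _ _
  (fun u => w p s i0 j0 i j (g u) * expR (w0 p s i0 j0 (g u) * pgap p s (g u) i j))).
  by near=> u; rewrite [RHS]Z_w //; near: u.
apply: (is_derive_eq (is_derive_mulr (Hw _ _ ij neq) (Hexp i j))).
by rewrite mul0r mulr0 addr0.
Unshelve. all: by end_near. Qed.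

Let oH : open H. Proof. exact: Hset_open. Qed.

Lemma pgap_Ck k i j : Ck k H (fun M => pgap p s M i j).
Proof.
have CD := @lvD_mxCk R n k s.
by apply: CkB => //; apply: Ck_horner => //; apply: Ck_subset (CD _ _).
Qed.

Lemma lz_Ck k : Ck k H lz.
Proof.
have [_ CZ] := @lvYZ_mxCk R n k s.
apply: Ck_ln => // [M []//|]; apply: CkM => //; first exact: Ck_cst.
exact: Ck_subset (CZ _ _).
Qed.

Lemma w0_Ck k : Ck k H (w0 p s i0 j0).
Proof.
apply: (@Ck_ext _ _ _ _ (fun M => lz M / gap0 M)) => // [M HM|]; first by rewrite w0E.
by apply: Ck_div => //; [exact: gap0_neq0|exact: lz_Ck|exact: pgap_Ck].
Qed.

Lemma w_Ck k i j : Ck k H (w p s i0 j0 i j).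
Proof.
have [_ CZ] := @lvYZ_mxCk R n k s.
apply: (@Ck_ext _ _ _ _ (fun M => lvZ s M i j * expR (- (eps p s i0 j0 i j M * lz M)))) => //.
  by move=> M HM; rewrite wE.
apply: CkM => //; first exact: Ck_subset (CZ _ _).
apply: Ck_expR => //; apply: CkN => //; apply: CkM => //; last exact: lz_Ck.
by apply: Ck_div => //; [exact: gap0_neq0|exact: pgap_Ck|exact: pgap_Ck].
Qed.

(* The conserved quantities are the entries of the matrix with the eigenvalues on the
   diagonal, y_ji above it and w_ij below it, except for the entry (i0, j0); adding
   w0 there completes them to a local coordinate system. *)
Definition quantity (q : 'I_n.+1 * 'I_n.+1) (M : 'M[R]_n.+1) : R :=
  if q.1 == q.2 then lvD s M q.1 q.1
  else if (q.1 < q.2)%N then lvY s M q.2 q.1 else w p s i0 j0 q.1 q.2 M.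

Definition coordinate (q : 'I_n.+1 * 'I_n.+1) : 'M[R]_n.+1 -> R :=
  if q == (i0, j0) then w0 p s i0 j0 else quantity q.

Lemma quantity_Ck k q : Ck k H (quantity q).
Proof.
have CD := @lvD_mxCk R n k s; have [CY _] := @lvYZ_mxCk R n k s.
rewrite /quantity; case: (q.1 == q.2); first exact: Ck_subset (CD _ _).
by case: ltnP => _; [exact: Ck_subset (CY _ _)|exact: w_Ck].
Qed.

Lemma coordinate_Ck k q : Ck k H (coordinate q).
Proof. by rewrite /coordinate; case: (q == _); [exact: w0_Ck|exact: quantity_Ck]. Qed.

Lemma coordinate_quantity q : q != (i0, j0) -> coordinate q = quantity q.
Proof. by rewrite /coordinate => /negPf ->. Qed.

(** The direction v is tested along the line M + u v: there D, Y and w have zero derivative at u =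
    0, hence so has Z, and [lv_curve_inj] applies. *)
Lemma coordinate_diff_inj M v : H M -> (forall q, 'd (coordinate q) M v = 0) -> v = 0.
Proof.
move=> HM dq; pose g (u : R) := M + u *: v.
have g0 : g 0 = M by rewrite /g scale0r addr0.
have dg : is_derive (0 : R) (1 : R) g v.
  apply/is_derive_mxP => i j.
  have -> : (fun u => g u i j) = (fun u => M i j + u * v i j).
    by apply/funext => u; rewrite !mxE.
  have D1 := is_derive_mulr (is_derive_id (0 : R) (1 : R)) (is_derive_cst (v i j) (0 : R) (1 : R)).
  apply: (is_derive_eq (is_deriveD (is_derive_cst (M i j) (0 : R) (1 : R)) D1)).
  by rewrite add0r mulr0 addr0 mul1r.
have H0 : H (g 0) by rewrite g0.
have nH : \forall u \near (0 : R), H (g u) by exact: (@curve_near _ _ _ _ _ H Hset_open H0 dg).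
have Dq q : is_derive (0 : R) (1 : R) (fun u => coordinate q (g u)) 0.
  have [dfq _] := coordinate_Ck 1 q; have {}dfq := dfq _ H0.
  by apply: (is_derive_eq (is_derive_comp_curve dfq dg)); rewrite g0.
have HD : is_derive (0 : R) (1 : R) (fun u => lvD s (g u)) 0.
  apply/is_derive_mxP => i j; rewrite mxE; have [<-|ij] := eqVneq i j.
    have ne : (i, i) != (i0, j0).
      by apply/eqP => -[ii0 ij]; move: ij0; rewrite -ii0 -ij eqxx.
    by have := Dq (i, i); rewrite coordinate_quantity // /quantity /= eqxx.
  apply: (@near_eq_is_derive _ _ _ (cst 0)).
  near=> u; have Hu : H (g u) by near: u.
  by have [_ ->] := lv_UGL (HU Hu).
have HY : is_derive (0 : R) (1 : R) (fun u => lvY s (g u)) 0.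
  apply/is_derive_mxP => i j; rewrite mxE; case: (leqP i j) => ij.
    apply: (@near_eq_is_derive _ _ _ (cst 0)).
    near=> u; have Hu : H (g u) by near: u.
    by have [_ _ ->] := lv_UGL (HU Hu).
  have ne : (j, i) != (i0, j0).
    by apply/eqP => -[ji ii]; move: hij0 ij; rewrite -ji -ii; lia.
  have := Dq (j, i); rewrite coordinate_quantity // /quantity /= ij.
  by rewrite -val_eqE /= ltn_eqF.
have Hw0 : is_derive (0 : R) (1 : R) (fun u => w0 p s i0 j0 (g u)) 0.
  by have := Dq (i0, j0); rewrite /coordinate eqxx.
apply: (lv_curve_inj (HU H0) dg HD HY); apply: is_derive_lvZ0 => // i j ji /eqP ne.
have := Dq (i, j); rewrite coordinate_quantity // /quantity /= ltnNge ltnW //=.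
by rewrite -val_eqE /= gtn_eqF.
Unshelve. all: by end_near. Qed.

(** There are as many coordinates as matrix entries, so the differentials together form an
    endomorphism of the space of matrices; being injective, it is bijective. *)
Lemma coordinate_diff_surj M (B : 'M[R]_n.+1) : H M ->
  exists v, forall q, 'd (coordinate q) M v = B q.1 q.2.
Proof.
move=> HM; pose phi (v : 'M[R]_n.+1) : 'M[R]_n.+1 := \matrix_(i, j) 'd (coordinate (i, j)) M v.
have lphi : linear phi.
  by move=> a u v; apply/matrixP => i j; rewrite !mxE linearP.
pose phiM := GRing.isLinear.Build _ _ _ _ _ lphi.
pose phiL : {linear 'M[R]_n.+1 -> 'M[R]_n.+1} := HB.pack phi phiM.
have uA : lin_mx phiL \in unitmx.
  rewrite -row_free_unit; apply: inj_row_free => u uA0.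
  rewrite -[u]vec_mxK; suff -> : vec_mx u = 0 by rewrite linear0.
  apply: (coordinate_diff_inj HM) => -[i j].
  have := mul_rV_lin phiL u; rewrite uA0 => /esym/(congr1 vec_mx).
  by rewrite mxvecK linear0 => /matrixP/(_ i j); rewrite !mxE.
exists (vec_mx (mxvec B *m invmx (lin_mx phiL))) => -[i j] /=.
have := mul_rV_lin phiL (mxvec B *m invmx (lin_mx phiL)).
rewrite mulmxKV // => /(can_inj mxvecK)/matrixP/(_ i j) ->.
by rewrite mxE.
Qed.

Lemma card_quantities : (n.+1 * n.+1).-1 = #|[set~ (i0, j0)]%SET|.
Proof. by rewrite cardsC1 card_prod !card_ord. Qed.

Definition quantity_index (k : 'I_(n.+1 * n.+1).-1) : 'I_n.+1 * 'I_n.+1 :=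
  enum_val (cast_ord card_quantities k).

Lemma quantity_index_neq k : quantity_index k != (i0, j0).
Proof. by have := enum_valP (cast_ord card_quantities k); rewrite !inE. Qed.

Lemma quantity_index_inj : injective quantity_index.
Proof. by move=> k l /enum_val_inj /cast_ord_inj. Qed.

(** Evaluating the linear relation in a direction along which a single coordinate varies isolates
    its coefficient. *)
Lemma quantities_independent :
  functionally_independent H (fun k => quantity (quantity_index k)).
Proof.
move=> M HM c Hc k; set q := quantity_index k.
have [v Hv] := coordinate_diff_surj (delta_mx q.1 q.2) HM.
have := Hc v; rewrite (bigD1 k) //= big1 ?addr0.
  by rewrite -coordinate_quantity ?quantity_index_neq // Hv mxE !eqxx mulr1.
move=> l lk; rewrite -coordinate_quantity ?quantity_index_neq // Hv mxE.
rewrite -[_ && _]/(quantity_index l == q) (inj_eq quantity_index_inj) (negPf lk).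
by rewrite mulr0.
Qed.

Lemma toda_linearized J (g : R -> 'M[R]_n.+1) : integral_curve (toda p) H J g ->
  forall t, J t ->
    [/\ is_derive t (1 : R) (fun u => lvD s (g u)) (0 : 'M[R]_n.+1),
        is_derive t (1 : R) (fun u => lvY s (g u)) (0 : 'M[R]_n.+1),
        is_derive t (1 : R) (fun u => w0 p s i0 j0 (g u)) (1 : R) &
        forall i j : 'I_n.+1, (j < i)%N ->
          is_derive t (1 : R) (fun u => w p s i0 j0 i j (g u)) (0 : R)].
Proof.
move=> [_ _ Hg] t Jt; have [Ht dg] := Hg t Jt.
have [HD HY HZ] := toda_lv (HU Ht) dg; split=> //; first exact: is_derive_w0 dg HD HZ.
by move=> i j; exact: is_derive_w dg HD HZ i j.
Qed.

Lemma quantity_conserved q : q != (i0, j0) -> conserved (toda p) H (quantity q).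
Proof.
case: q => i j _ J g IC; have [_ iJ _] := IC.
apply: zero_derive_interval_cst => // t Jt.
have [HD HY _ Hw] := toda_linearized IC Jt; rewrite /quantity /=.
case: eqVneq => [_|ij].
  by have := (is_derive_mxP _ _ _ _).1 HD i i; rewrite mxE.
case: ltnP => ji; first by have := (is_derive_mxP _ _ _ _).1 HY j i; rewrite mxE.
by apply: Hw; rewrite ltn_neqAle ji eq_sym val_eqE ij.
Qed.

End WVariables.

Theorem theorem4 (R : realType) (n : nat) (s : 'S_n.+1) (i0 j0 : 'I_n.+1)
    (hij0 : (j0 < i0)%N) (sigma : R) (hsigma : sigma = 1 \/ sigma = -1)
    (p : {poly R}) (hp : (1 < size p)%N)
    (hmono : {homo (fun x : R => p.[x]) : x y / x <= y} \/
             {homo (fun x : R => p.[x]) : x y /~ x <= y}) :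
  [/\ open (Hset s i0 j0 sigma),
      (forall (J : set R) (M : R -> 'M[R]_n.+1),
         integral_curve (toda p) (Hset s i0 j0 sigma) J M ->
         forall t : R, J t ->
           [/\ is_derive t (1 : R) (fun u : R => lvD s (M u)) (0 : 'M[R]_n.+1),
               is_derive t (1 : R) (fun u : R => lvY s (M u)) (0 : 'M[R]_n.+1),
               is_derive t (1 : R) (fun u : R => w0 p s i0 j0 (M u)) (1 : R) &
               forall i j : 'I_n.+1, (j < i)%N -> (i, j) <> (i0, j0) ->
                 is_derive t (1 : R) (fun u : R => w p s i0 j0 i j (M u)) (0 : R)]) &
      super_integrable (n.+1 * n.+1) (toda p) (Hset s i0 j0 sigma)].
Proof.
split; first exact: Hset_open.
- move=> J M IC t Jt.
  have [HD HY Hw0 Hw] := toda_linearized hij0 hsigma hp hmono IC Jt.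
  by split=> // i j ji _; exact: Hw.
- exists (fun k => quantity s i0 j0 p (quantity_index i0 j0 k)); split.
    move=> k; split; first by move=> l; exact: quantity_Ck.
    by apply: quantity_conserved => //; exact: quantity_index_neq.
  exact: quantities_independent.
Qed.
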